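(* Let $n\ge 2$ and let $G$ be a free 2-nilpotent group of rank $n$. If $H$ is a group elementarily equivalent to $G$ (in the first-order language of groups), then $H\cong N_{2,n}(R,f^1,\ldots,f^n)$ for some ring $R$ with $R\equiv\mathbb{Z}$ (as rings) and some symmetric 2-cocycles $f^1,\ldots,f^n:R^+\times R^+\to\bigoplus_{1\le j<k\le n}R^+$.
   Context: The free 2-nilpotent group of rank $n$ is $F(n)/\Gamma_3(F(n))$, where $F(n)$ is the free group on $n$ generators, $\Gamma_1(F)=F$, $\Gamma_{k+1}(F)=[\Gamma_k(F),F]$. Two structures in the same language are elementarily equivalent ($\equiv$) if they satisfy the same first-order sentences. Rings have a unit; $R^+$ is the additive group of $R$. For abelian groups $A,B$, a 2-cocycle is a function $f:B\times B\to A$ with $f(0,x)=f(x,0)=0$ and $f(x+y,z)+f(x,y)=f(x,y+z)+f(y,z)$; it is symmetric if $f(x,y)=f(y,x)$ for all $x,y\in B$. Let $f^1,\ldots,f^n:R^+\times R^+\to\bigoplus_{1\le j<k\le n}R^+$ be symmetric 2-cocycles, with coordinates $f^i_{jk}$ $(1\le j<k\le n)$. $N_{2,n}(R,f^1,\ldots,f^n)$ is the set of all tuples $((\alpha_i)_{1\le i\le n},(\gamma_{ij})_{1\le i<j\le n})$ of elements of $R$ with the group multiplication $$((\alpha_i),(\gamma_{ij}))\odot((\beta_i),(\gamma'_{ij}))=\Big((\alpha_i+\beta_i),\big(\gamma_{ij}+\gamma'_{ij}+\alpha_i\beta_j+\sum_{k=1}^n f^k_{ij}(\alpha_k,\beta_k)\big)\Big).$$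 *)

(* Defs.v *)
From HB Require Import structures.
From mathcomp Require Import all_boot all_order all_algebra.
From mathcomp Require Import boolp classical_sets.

Set Implicit Arguments.
Unset Strict Implicit.
Unset Printing Implicit Defensive.

Import GRing.Theory.

Local Open Scope quotient_scope.

(* There are only function symbols: the languages of groups and of rings have
   no relation symbol besides equality. *)

Record signature := Signature { fsym : Type; arity : fsym -> nat }.

Record structure (L : signature) := Structure {
  carrier :> Type;
  interp : forall s : fsym L, ('I_(arity s) -> carrier) -> carrier }.

Inductive term (L : signature) :=
| Var of nat
| App (s : fsym L) of ('I_(arity s) -> term L).

Inductive formula (L : signature) :=
| Equal of term L & term L
| Not of formula L
| And of formula L & formula L
| Or of formula L & formula L
| Implies of formula L & formula L
| Forall of nat & formula L
| Exists of nat & formula L.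

Section Semantics.
Variables (L : signature) (M : structure L).

Fixpoint eval (e : nat -> M) (t : term L) : M :=
  match t with
  | Var x => e x
  | App s a => interp (fun i => eval e (a i))
  end.

Definition update (e : nat -> M) (x : nat) (m : M) : nat -> M :=
  fun y => if y == x then m else e y.

Fixpoint holds (e : nat -> M) (phi : formula L) : Prop :=
  match phi with
  | Equal t u => eval e t = eval e u
  | Not p => ~ holds e p
  | And p q => holds e p /\ holds e q
  | Or p q => holds e p \/ holds e q
  | Implies p q => holds e p -> holds e q
  | Forall x p => forall m : M, holds (update e x m) p
  | Exists x p => exists m : M, holds (update e x m) p
  end.

(* Only meant for sentences, whose truth value does not depend on [e]. *)
Definition models (phi : formula L) : Prop := forall e : nat -> M, holds e phi.

End Semantics.

Fixpoint free_in_term (L : signature) (x : nat) (t : term L) : Prop :=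
  match t with
  | Var y => y = x
  | App s a => exists i, free_in_term x (a i)
  end.

Fixpoint free_in (L : signature) (x : nat) (phi : formula L) : Prop :=
  match phi with
  | Equal t u => free_in_term x t \/ free_in_term x u
  | Not p => free_in x p
  | And p q | Or p q | Implies p q => free_in x p \/ free_in x q
  | Forall y p | Exists y p => y <> x /\ free_in x p
  end.

Definition sentence (L : signature) (phi : formula L) : Prop :=
  forall x, ~ free_in x phi.

Definition elementarily_equivalent (L : signature) (M N : structure L) : Prop :=
  forall phi : formula L, sentence phi -> (models M phi <-> models N phi).

Inductive group_symbol := GOne | GInv | GMul.

Definition group_language : signature :=
  Signature (fun s => match s with GOne => 0 | GInv => 1 | GMul => 2 end).

Definition group_structure (G : groupType) : structure group_language :=
  @Structure group_language G (fun s =>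
    match s as s0
    return ('I_(@arity group_language s0) -> G) -> G with
    | GOne => fun _ => 1%g
    | GInv => fun a => (a ord0)^-1%g
    | GMul => fun a => (a ord0 * a ord_max)%g
    end).

Inductive ring_symbol := RZero | ROne | ROpp | RAdd | RMul.

Definition ring_language : signature :=
  Signature (fun s => match s with
                      | RZero | ROne => 0 | ROpp => 1 | RAdd | RMul => 2
                      end).

Definition ring_structure (R : pzRingType) : structure ring_language :=
  @Structure ring_language R (fun s =>
    match s as s0
    return ('I_(@arity ring_language s0) -> R) -> R with
    | RZero => fun _ => 0%R
    | ROne => fun _ => 1%R
    | ROpp => fun a => (- a ord0)%R
    | RAdd => fun a => (a ord0 + a ord_max)%R
    | RMul => fun a => (a ord0 * a ord_max)%R
    end).

Definition isomorphic (G H : groupType) : Prop :=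
  exists f : {multiplicative G -> H}, bijective f.

Local Open Scope classical_set_scope.
Local Open Scope group_scope.

Section Subgroups.
Variable G : groupType.
Implicit Types A S : set G.

Definition subgroup A : Prop :=
  [/\ A 1, forall x y, A x -> A y -> A (x * y) & forall x, A x -> A x^-1].

Definition normal_subgroup A : Prop :=
  subgroup A /\ forall x y, A x -> A (x ^ y).

Definition generated S : set G := smallest subgroup S.

Definition commutator_subgroup A B : set G :=
  generated [set z | exists2 x, A x & exists2 y, B y & z = [~ x, y]].

(* Indexed from 1, as usual; the value at 0 is a dummy. *)
Fixpoint lower_central (k : nat) : set G :=
  match k with
  | 0 | 1 => setT
  | k'.+1 => commutator_subgroup (lower_central k') setT
  end.

Lemma subgroup_generated S : subgroup (generated S).
Proof.
split=> [A [[A1 _ _] _] //|x y Sx Sy A [sA SA]|x Sx A [sA SA]].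
  by case: (sA) => _ AM _; apply: AM; [apply: Sx|apply: Sy].
by case: (sA) => _ _ AV; apply: AV; apply: Sx.
Qed.

Lemma normal_generated S :
  (forall x y, S x -> S (x ^ y)) -> normal_subgroup (generated S).
Proof.
move=> SJ; split=> [|x y Sx]; first exact: subgroup_generated.
have [g1 gM gV] := subgroup_generated S.
have sub : subgroup [set z | generated S (z ^ y)].
  split=> [|u v Su Sv|u Su] /=; rewrite ?conj1g ?conjMg ?conjVg //.
  - exact: gM.
  - exact: gV.
by apply: (Sx [set z | generated S (z ^ y)]); split=> // z Sz A [_]; apply; apply: SJ.
Qed.

Lemma normal_lower_central k : normal_subgroup (lower_central k).
Proof.
elim: k => [|[|k] IHk]; try by [].
apply: normal_generated => _ z [x Ax [y _ ->]].
by exists (x ^ z); [apply: IHk.2|exists (y ^ z) => //; rewrite conjRg].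
Qed.

End Subgroups.

Section Quotient.
Variables (G : groupType) (A : set G).

Definition coset_eq (nA : normal_subgroup A) : rel G :=
  fun x y => `[< A (x^-1 * y) >].

Variable nA : normal_subgroup A.

Lemma coset_eq_refl : reflexive (coset_eq nA).
Proof. by move=> x; apply/asboolP; rewrite mulVg; case: nA => -[]. Qed.

Lemma coset_eq_sym : symmetric (coset_eq nA).
Proof.
have [[_ _ AV] _] := nA.
by move=> x y; apply/asboolP/asboolP => /AV; rewrite invgM invgK.
Qed.

Lemma coset_eq_trans : transitive (coset_eq nA).
Proof.
have [[_ AM _] _] := nA.
move=> y x z /asboolP xy /asboolP yz; apply/asboolP.
by have := AM _ _ xy yz; rewrite -mulgA mulVKg.
Qed.

Canonical coset_eq_equiv :=
  EquivRel (coset_eq nA) coset_eq_refl coset_eq_sym coset_eq_trans.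

Definition quotient_group : Type := {eq_quot (coset_eq nA)}.

HB.instance Definition _ := EqQuotient.on quotient_group.
HB.instance Definition _ := Choice.copy quotient_group {eq_quot (coset_eq nA)}.

Definition quotient_one : quotient_group := \pi_quotient_group 1.
Definition quotient_mul (u v : quotient_group) : quotient_group :=
  \pi_quotient_group (repr u * repr v).
Definition quotient_inv (u : quotient_group) : quotient_group :=
  \pi_quotient_group (repr u)^-1.

Lemma coset_reprP x : A (x^-1 * repr (\pi_quotient_group x)).
Proof. by apply/asboolP; rewrite -[asbool _]/(coset_eq nA _ _) -(eqquotE quotient_group) reprK. Qed.

Lemma coset_piP x y :
  A (x^-1 * y) -> \pi_quotient_group x = \pi_quotient_group y.
Proof. by move=> Axy; apply/eqP; rewrite eqquotE; apply/asboolP. Qed.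

Lemma quotient_mulE x y :
  quotient_mul (\pi x) (\pi y) = \pi_quotient_group (x * y).
Proof.
have [[_ AM _] AJ] := nA; apply/esym/coset_piP.
set x' := repr _; set y' := repr _.
have -> : (x * y)^-1 * (x' * y') = (x^-1 * x') ^ y * (y^-1 * y').
  by rewrite conjgE invgM !mulgA mulgK.
by apply: AM; [apply/AJ|]; apply: coset_reprP.
Qed.

Lemma quotient_invE x : quotient_inv (\pi x) = \pi_quotient_group x^-1.
Proof.
have [[_ _ AV] AJ] := nA; apply/esym/coset_piP.
set x' := repr _.
have -> : x^-1^-1 * x'^-1 = ((x^-1 * x')^-1) ^ x^-1.
  by rewrite conjgE invgM !invgK mulgK.
by apply/AJ/AV/coset_reprP.
Qed.

Lemma quotient_mulA : associative quotient_mul.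
Proof.
by elim/quotW=> x; elim/quotW=> y; elim/quotW=> z; rewrite !quotient_mulE mulgA.
Qed.

Lemma quotient_mul1x : left_id quotient_one quotient_mul.
Proof. by elim/quotW=> x; rewrite quotient_mulE mul1g. Qed.

Lemma quotient_mulx1 : right_id quotient_one quotient_mul.
Proof. by elim/quotW=> x; rewrite quotient_mulE mulg1. Qed.

Lemma quotient_mulVx : left_inverse quotient_one quotient_inv quotient_mul.
Proof. by elim/quotW=> x; rewrite quotient_invE quotient_mulE mulVg. Qed.

Lemma quotient_mulxV : right_inverse quotient_one quotient_inv quotient_mul.
Proof. by elim/quotW=> x; rewrite quotient_invE quotient_mulE mulgV. Qed.

HB.instance Definition _ := isGroup.Build quotient_group
  quotient_mulA quotient_mul1x quotient_mulx1 quotient_mulVx quotient_mulxV.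

End Quotient.

Section FreeGroup.
Variable n : nat.

(* [(i, true)] stands for the i-th generator, [(i, false)] for its inverse. *)
Definition word := seq ('I_n * bool).

Definition letter_inv (a : 'I_n * bool) : 'I_n * bool := (a.1, ~~ a.2).

Definition word_inv (w : word) : word := rev (map letter_inv w).

Inductive free_equiv : word -> word -> Prop :=
| FreeCancel u v a : free_equiv (u ++ a :: letter_inv a :: v) (u ++ v)
| FreeRefl u : free_equiv u u
| FreeSym u v : free_equiv u v -> free_equiv v u
| FreeTrans u v w : free_equiv u v -> free_equiv v w -> free_equiv u w.

Definition free_eq : rel word := fun u v => `[< free_equiv u v >].

Lemma free_eq_refl : reflexive free_eq.
Proof. by move=> u; apply/asboolP/FreeRefl. Qed.

Lemma free_eq_sym : symmetric free_eq.
Proof. by move=> u v; apply/asboolP/asboolP => /FreeSym. Qed.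

Lemma free_eq_trans : transitive free_eq.
Proof.
move=> v u w /asboolP uv /asboolP vw.
by apply/asboolP/(FreeTrans uv).
Qed.

Canonical free_eq_equiv := EquivRel free_eq free_eq_refl free_eq_sym free_eq_trans.

Definition free_group : Type := {eq_quot free_eq}.

HB.instance Definition _ := EqQuotient.on free_group.
HB.instance Definition _ := Choice.copy free_group {eq_quot free_eq}.

Definition free_one : free_group := \pi_free_group [::].
Definition free_mul (x y : free_group) : free_group := \pi_free_group (repr x ++ repr y).
Definition free_inv (x : free_group) : free_group := \pi_free_group (word_inv (repr x)).

Lemma free_reprP w : free_equiv w (repr (\pi_free_group w)).
Proof. by apply/asboolP; rewrite -[asbool _]/(free_eq _ _) -(eqquotE free_group) reprK. Qed.

Lemma free_piP u v : free_equiv u v -> \pi_free_group u = \pi_free_group v.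
Proof. by move=> uv; apply/eqP; rewrite eqquotE; apply/asboolP. Qed.

Lemma letter_invK : involutive letter_inv.
Proof. by case=> i b; rewrite /letter_inv negbK. Qed.

Lemma free_equiv_cat u u' v v' :
  free_equiv u u' -> free_equiv v v' -> free_equiv (u ++ v) (u' ++ v').
Proof.
move=> uu' vv'; apply: (@FreeTrans _ (u' ++ v)).
  elim: uu' => {u u'} [u u' a|?|? ? _ IH|? ? ? _ IH1 _ IH2].
  - by rewrite -!catA !cat_cons; apply: FreeCancel.
  - exact: FreeRefl.
  - exact: FreeSym IH.
  - exact: FreeTrans IH1 IH2.
elim: vv' => {v v'} [v v' a|?|? ? _ IH|? ? ? _ IH1 _ IH2].
- by rewrite !catA; apply: FreeCancel.
- exact: FreeRefl.
- exact: FreeSym IH.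
- exact: FreeTrans IH1 IH2.
Qed.

Lemma free_equiv_inv u v : free_equiv u v -> free_equiv (word_inv u) (word_inv v).
Proof.
elim=> {u v} [u v a|?|? ? _ IH|? ? ? _ IH1 _ IH2].
- rewrite /word_inv !map_cat !rev_cat /= !rev_cons -!cats1 -!catA letter_invK /=.
  exact: FreeCancel.
- exact: FreeRefl.
- exact: FreeSym IH.
- exact: FreeTrans IH1 IH2.
Qed.

Lemma free_mulE u v : free_mul (\pi u) (\pi v) = \pi_free_group (u ++ v).
Proof. by apply/esym/free_piP/free_equiv_cat; apply: free_reprP. Qed.

Lemma free_invE u : free_inv (\pi u) = \pi_free_group (word_inv u).
Proof. by apply/esym/free_piP/free_equiv_inv/free_reprP. Qed.

Lemma free_mulA : associative free_mul.
Proof.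
by elim/quotW=> x; elim/quotW=> y; elim/quotW=> z; rewrite !free_mulE catA.
Qed.

Lemma free_mul1x : left_id free_one free_mul.
Proof. by elim/quotW=> x; rewrite free_mulE. Qed.

Lemma free_mulx1 : right_id free_one free_mul.
Proof. by elim/quotW=> x; rewrite free_mulE cats0. Qed.

Lemma free_equiv_mulV u : free_equiv (u ++ word_inv u) [::].
Proof.
elim: u => [|a u IHu]; first exact: FreeRefl.
rewrite /word_inv /= rev_cons -cats1 catA -/(word_inv u).
apply: (@FreeTrans _ ([:: a] ++ [::] ++ [:: letter_inv a])).
  apply: (@free_equiv_cat [:: a] [:: a]); first exact: FreeRefl.
  by apply: free_equiv_cat => //; apply: FreeRefl.
exact: (FreeCancel [::] [::]).
Qed.

Lemma word_invK : involutive word_inv.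
Proof.
by move=> u; rewrite /word_inv map_rev revK mapK //; apply: letter_invK.
Qed.

Lemma free_mulVx : left_inverse free_one free_inv free_mul.
Proof.
elim/quotW=> x; rewrite free_invE free_mulE; apply: free_piP.
by rewrite -{2}(word_invK x); apply: free_equiv_mulV.
Qed.

Lemma free_mulxV : right_inverse free_one free_inv free_mul.
Proof.
elim/quotW=> x; rewrite free_invE free_mulE; apply: free_piP.
exact: free_equiv_mulV.
Qed.

HB.instance Definition _ := isGroup.Build free_group
  free_mulA free_mul1x free_mulx1 free_mulVx free_mulxV.

End FreeGroup.

Definition free_2nilpotent (n : nat) : groupType :=
  quotient_group (normal_lower_central (free_group n) 3).

Local Open Scope ring_scope.

Record sym_cocycle (B A : zmodType) := SymCocycle {
  cocycle_fun :> B -> B -> A;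
  cocycle0x : forall x, cocycle_fun 0 x = 0;
  cocyclex0 : forall x, cocycle_fun x 0 = 0;
  cocycleD : forall x y z,
    cocycle_fun (x + y) z + cocycle_fun x y =
    cocycle_fun x (y + z) + cocycle_fun y z;
  cocycleC : forall x y, cocycle_fun x y = cocycle_fun y x }.

(* The pairs (i, j) with i < j; [{ffun opair n -> R}] is the direct sum of the
   copies of R^+ indexed by them. *)
Definition opair (n : nat) : finType := {p : 'I_n * 'I_n | (p.1 < p.2)%N}.

(* N_{2,n}(R, f^1, ..., f^n), with [f k] for the cocycle f^{k+1} and
   coordinates numbered from 0; [f] only matters for the group law with which this type is equipped. *)
Definition N2 (n : nat) (R : pzRingType)
    (f : 'I_n -> sym_cocycle R {ffun opair n -> R}) : Type :=
  ({ffun 'I_n -> R} * {ffun opair n -> R})%type.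

Section N2.
Variables (n : nat) (R : pzRingType).
Variable f : 'I_n -> sym_cocycle R {ffun opair n -> R}.

HB.instance Definition _ :=
  Choice.copy (N2 f) ({ffun 'I_n -> R} * {ffun opair n -> R})%type.

Definition N2_one : N2 f := (0, 0).

Definition N2_mul (u v : N2 f) : N2 f :=
  ([ffun i => u.1 i + v.1 i],
   [ffun p => u.2 p + v.2 p + u.1 (val p).1 * v.1 (val p).2
              + \sum_(k < n) f k (u.1 k) (v.1 k) p]).

Definition N2_inv (u : N2 f) : N2 f :=
  ([ffun i => - u.1 i],
   [ffun p => - u.2 p + u.1 (val p).1 * u.1 (val p).2
              - \sum_(k < n) f k (u.1 k) (- u.1 k) p]).

Lemma N2_mulA : associative N2_mul.
Proof.
move=> u v w; congr pair; apply/ffunP => i; rewrite !ffunE /=; first by rewrite addrA.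
set p := val i.
have cocycle_sum :
    \sum_(k < n) f k (v.1 k) (w.1 k) i
      + \sum_(k < n) f k (u.1 k) ([ffun j => v.1 j + w.1 j] k) i =
    \sum_(k < n) f k (u.1 k) (v.1 k) i
      + \sum_(k < n) f k ([ffun j => u.1 j + v.1 j] k) (w.1 k) i.
  rewrite -!big_split /=; apply: eq_bigr => k _; rewrite !ffunE.
  have /ffunP/(_ i) := cocycleD (f k) (u.1 k) (v.1 k) (w.1 k).
  by rewrite !ffunE => H; rewrite [LHS]addrC -H addrC.
rewrite mulrDl mulrDr.
transitivity (u.2 i + v.2 i + w.2 i
    + (u.1 p.1 * v.1 p.2 + u.1 p.1 * w.1 p.2 + v.1 p.1 * w.1 p.2)
    + (\sum_(k < n) f k (v.1 k) (w.1 k) i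
       + \sum_(k < n) f k (u.1 k) ([ffun j => v.1 j + w.1 j] k) i)).
  by rewrite [LHS](AC (1*(1*1*1*1)*(1*1)*1) (1*2*3*(6*7*4)*(5*8))).
rewrite cocycle_sum.
by rewrite [LHS](AC (1*1*1*(1*1*1)*(1*1)) ((1*2*4*7)*3*(5*6)*8)).
Qed.

Lemma N2_mul1x : left_id N2_one N2_mul.
Proof.
move=> [a c]; congr pair; apply/ffunP => i; rewrite !ffunE /= ?add0r //.
by rewrite mul0r addr0 big1 ?addr0 // => k _; rewrite ffunE cocycle0x ffunE.
Qed.

Lemma N2_mulx1 : right_id N2_one N2_mul.
Proof.
move=> [a c]; congr pair; apply/ffunP => i; rewrite !ffunE /= ?addr0 //.
by rewrite mulr0 addr0 big1 ?addr0 // => k _; rewrite ffunE cocyclex0 ffunE.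
Qed.

Lemma N2_mulVx : left_inverse N2_one N2_inv N2_mul.
Proof.
move=> [a c]; congr pair; apply/ffunP => i; rewrite !ffunE /= ?addNr //.
under [X in _ + X]eq_bigr do rewrite ffunE cocycleC.
rewrite mulNr.
set s := \sum_(k < n) _; set m := a _ * a _.
by rewrite [LHS](AC (1*1*1*1*1*1) ((1*4)*(2*5)*(3*6))) /= !addNr subrr !addr0.
Qed.

Lemma N2_mulxV : right_inverse N2_one N2_inv N2_mul.
Proof.
move=> [a c]; congr pair; apply/ffunP => i; rewrite !ffunE /= ?subrr //.
under [X in _ + X]eq_bigr do rewrite ffunE.
rewrite mulrN.
set s := \sum_(k < n) _; set m := a _ * a _.
by rewrite [LHS](AC (1*(1*1*1)*1*1) ((1*2)*(3*5)*(4*6))) /= subrr !addNr subrr !addr0.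
Qed.

HB.instance Definition _ := isGroup.Build (N2 f)
  N2_mulA N2_mul1x N2_mulx1 N2_mulVx N2_mulxV.

End N2.

(* Main.v *)
From HB Require Import structures.
Require Import Defs.
From mathcomp Require Import all_boot all_order all_algebra.
From mathcomp Require Import boolp ring.

Set Implicit Arguments.
Unset Strict Implicit.
Unset Printing Implicit Defensive.

Import Order.TTheory GRing.Theory Num.Theory.

(** The free 2-nilpotent group of rank [n] is the group [N2] over the integers
    with zero cocycles ([free_2nilpotent_intN2]), so [H] has the same theory as
    that group. The idea, due to Mal'cev, is that the coordinates of this group
    can be recovered from the group law by means of first-order formulas whose
    parameters are the generators [b i].

    The formulas say the following. The elements commuting with [b i] form an
    abelian subgroup, which modulo the center is the [i]-th axis, and the whole
    group is modulo the center the direct product of the axes. The scalars are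
    the commutators [[~ x, b 1]] with [x] on the axis of [b 0]; they form an
    abelian group, on which [[~ x, b 1] * [~ b 0, y] := [~ x, y]] is a
    multiplication with unit [[~ b 0, b 1]]. Modulo the center, every axis is
    identified with the scalars, and the center is the direct sum of the groups
    [[~ b i, y]], with [i < j] and [y] on the axis of [b j]. A family [b] with
    all these properties is called a frame here, and being a frame is
    expressed by a single formula ([definable_frame]).

    Two facts about frames carry the proof. In any group [K], a frame makes the
    scalars a ring [R] and yields an isomorphism between [K] and [N2] over [R]
    ([frame_isomorphic]): choose for each axis a section of the quotient by the
    center; how far it is from being additive is measured by a 2-cocycle, which
    is symmetric because the axis is abelian. In the integral group, the ring
    of scalars of every frame, not only of the standard one, has the theory of
    the integers ([intN2_scalars]): its additive group embeds into the
    integers, and such a ring is either trivial or isomorphic to the integers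
    ([ring_embedded_in_int]).

    Truth of a ring sentence among the scalars is itself a group formula in the
    parameters [b] ([definable_scalar_holds]). The existence of a frame and, for
    each sentence true in the integers, its truth in the rings of scalars of all
    frames, are thus sentences true in the integral group, hence in [H]
    ([definable_transfer]). The quantification over all frames is essential:
    one and the same frame of [H] then gives a ring satisfying every sentence
    that is true in the integers. *)

(** * First-order logic *)

Section Sentences.
Variable L : signature.
Implicit Types (phi : formula L) (t : term L).

Lemma eval_agree (M : structure L) (e e' : nat -> M) t :
  (forall x, free_in_term x t -> e x = e' x) -> eval e t = eval e' t.
Proof.
elim: t => [x|s a IHa] /= ee'; first exact: ee'.
by congr interp; apply/funext => i; apply: IHa => x xi; apply: ee'; exists i.
Qed.

Lemma holds_agree (M : structure L) phi : forall e e' : nat -> M,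
  (forall x, free_in x phi -> e x = e' x) -> holds e phi <-> holds e' phi.
Proof.
elim: phi => [t u|p IHp|p IHp q IHq|p IHp q IHq|p IHp q IHq|x p IHp|x p IHp] e e' /= ee'.
- by rewrite (@eval_agree _ e e' t) ?(@eval_agree _ e e' u) // => x ?; apply: ee'; [right|left].
- by have := IHp e e' ee'; tauto.
- have := IHp e e' (fun x xp => ee' x (or_introl xp)).
  by have := IHq e e' (fun x xq => ee' x (or_intror xq)); tauto.
- have := IHp e e' (fun x xp => ee' x (or_introl xp)).
  by have := IHq e e' (fun x xq => ee' x (or_intror xq)); tauto.
- have := IHp e e' (fun x xp => ee' x (or_introl xp)).
  by have := IHq e e' (fun x xq => ee' x (or_intror xq)); tauto.
- have ee'x m y : free_in y p -> update e x m y = update e' x m y.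
    by rewrite /update; case: eqP => // /eqP yx yp; apply: ee'; split=> //; apply/eqP; rewrite eq_sym.
  by split=> H m; [rewrite -(IHp _ _ (ee'x m))|rewrite (IHp _ _ (ee'x m))].
- have ee'x m y : free_in y p -> update e x m y = update e' x m y.
    by rewrite /update; case: eqP => // /eqP yx yp; apply: ee'; split=> //; apply/eqP; rewrite eq_sym.
  by split=> -[m H]; exists m; [rewrite -(IHp _ _ (ee'x m))|rewrite (IHp _ _ (ee'x m))].
Qed.

Lemma sentence_holds (M : structure L) phi (e e' : nat -> M) :
  sentence phi -> holds e phi <-> holds e' phi.
Proof. by move=> sphi; apply: holds_agree => x /sphi. Qed.

Lemma sentence_models (M : structure L) phi (e : nat -> M) :
  sentence phi -> models M phi <-> holds e phi.
Proof.
by move=> sphi; split=> [/(_ e)//|H e']; apply/(sentence_holds e' e).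
Qed.

(** Transferring truth in one direction is enough: for the other direction,
    transfer the truth of the negation. *)
Lemma elementarily_equivalentP (M N : structure L) (m : M) (n : N) :
  (forall phi, sentence phi -> models M phi -> models N phi) ->
  elementarily_equivalent M N.
Proof.
move=> MN phi sphi; split; first exact: MN.
move=> Nphi; apply: contrapT => nM.
suff /(MN (Not phi) sphi)/(_ (fun=> n)) : models M (Not phi) by apply; apply: Nphi.
by move=> e /= he; apply: nM; apply/(sentence_models e).
Qed.

Lemma holds_iso (M N : structure L) (f : M -> N) (g : N -> M) :
    cancel g f -> cancel f g ->
    (forall s (a : 'I_(arity s) -> M), f (interp a) = interp (fun i => f (a i))) ->
  forall phi e, holds e phi <-> holds (fun x => f (e x)) phi.
Proof.
move=> gK fK fM.
have fE (e : nat -> M) t : f (eval e t) = eval (fun x => f (e x)) t.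
  elim: t => //= s a IHa; rewrite fM; congr interp; exact: funext.
have fupd e x m : (fun y => f (update e x m y)) = update (fun y => f (e y)) x (f m).
  by apply/funext => y; rewrite /update; case: eqP.
elim=> [t u|p IHp|p IHp q IHq|p IHp q IHq|p IHp q IHq|x p IHp|x p IHp] e /=.
- by rewrite -!fE; split=> [->//|/(can_inj fK)].
- by rewrite IHp.
- by rewrite IHp IHq.
- by rewrite IHp IHq.
- by rewrite IHp IHq.
- split=> H m; last by rewrite IHp fupd.
  by rewrite -(gK m) -fupd -IHp.
- split=> -[m H]; first by exists (f m); rewrite -fupd -IHp.
  by exists (g m); rewrite IHp fupd gK.
Qed.

Lemma iso_elementarily_equivalent (M N : structure L) (f : M -> N) (g : N -> M) :
    cancel g f -> cancel f g ->
    (forall s (a : 'I_(arity s) -> M), f (interp a) = interp (fun i => f (a i))) ->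
  elementarily_equivalent M N.
Proof.
move=> gK fK fM phi _; split=> H e; last by rewrite (holds_iso gK fK fM).
rewrite (_ : e = fun x => f (g (e x))); last by apply/funext => x; rewrite gK.
by rewrite -(holds_iso gK fK fM).
Qed.

Lemma free_in_term_bounded t : exists N, forall x, free_in_term x t -> x < N.
Proof.
elim: t => [y|s a IHa] /=; first by exists y.+1 => x ->.
have [N HN] := choice IHa.
exists (\max_i N i) => x [i /HN xN]; exact: leq_trans xN (leq_bigmax i).
Qed.

Lemma free_in_bounded phi : exists N, forall x, free_in x phi -> x < N.
Proof.
elim: phi => [t u|p [N HN]|p [N HN] q [N' HN']|p [N HN] q [N' HN']
             |p [N HN] q [N' HN']|y p [N HN]|y p [N HN]] /=.
- have [N HN] := free_in_term_bounded t; have [N' HN'] := free_in_term_bounded u.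
  by exists (maxn N N') => x []; [move/HN|move/HN']; rewrite leq_max => ->; rewrite ?orbT.
- by exists N.
- by exists (maxn N N') => x []; [move/HN|move/HN']; rewrite leq_max => ->; rewrite ?orbT.
- by exists (maxn N N') => x []; [move/HN|move/HN']; rewrite leq_max => ->; rewrite ?orbT.
- by exists (maxn N N') => x []; [move/HN|move/HN']; rewrite leq_max => ->; rewrite ?orbT.
- by exists N => x [_ /HN].
- by exists N => x [_ /HN].
Qed.

Definition forall_closure N phi := foldr (fun x p => Forall x p) phi (iota 0 N).

Lemma free_in_forall_closure N phi x : free_in x (forall_closure N phi) -> N <= x /\ free_in x phi.
Proof.
rewrite /forall_closure.
suff H s : free_in x (foldr (fun x p => Forall x p) phi s) -> x \notin s /\ free_in x phi.
  by move=> /H[]; rewrite mem_iota /= add0n -leqNgt.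
by elim: s => //= y s IHs [yx /IHs[xs xp]]; rewrite inE negb_or xs andbT; split=> //; apply/eqP => xy; apply: yx.
Qed.

(** Quantifying all the variables below a bound of the free ones turns a
    formula whose truth value happens to be the same in all environments into
    a sentence. *)
Lemma closed_formula (phi : formula L) :
  exists2 psi, sentence psi & forall (M : structure L) (P : Prop),
    inhabited M ->
    (forall e : nat -> M, holds e phi <-> P) -> (models M psi <-> P).
Proof.
have [N HN] := free_in_bounded phi; exists (forall_closure N phi).
  by move=> x /free_in_forall_closure[Nx /HN]; rewrite ltnNge Nx.
move=> M P [m] phiP.
have H s (e : nat -> M) : holds e (foldr (fun x p => Forall x p) phi s) <-> P.
  elim: s e => //= x s IHs e; split=> [/(_ m)|p m']; by rewrite IHs.
by split=> [/(_ (fun=> m))|p e]; rewrite /forall_closure H.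
Qed.

End Sentences.

Arguments iso_elementarily_equivalent {L M N} f g.

Lemma elementarily_equivalent_sym (L : signature) (M N : structure L) :
  elementarily_equivalent M N -> elementarily_equivalent N M.
Proof. by move=> MN phi /MN ->. Qed.

Lemma elementarily_equivalent_trans (L : signature) (M N P : structure L) :
  elementarily_equivalent M N -> elementarily_equivalent N P ->
  elementarily_equivalent M P.
Proof. by move=> MN NP phi sphi; rewrite MN // NP. Qed.

Lemma isomorphic_elementarily_equivalent (G H : groupType) :
  isomorphic G H -> elementarily_equivalent (group_structure G) (group_structure H).
Proof.
move=> [f [g fK gK]].
have f1 : f 1%g = 1%g by apply: (@mulgI _ (f 1%g)); rewrite -gmulfM !mulg1.
apply: (iso_elementarily_equivalent (f : group_structure G -> group_structure H) g gK fK).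
case=> a //=; last exact: gmulfM.
by apply: (@mulgI _ (f (a ord0))); rewrite -gmulfM !mulgV f1.
Qed.

(** * Definable relations in groups *)

Section Definability.
Local Open Scope group_scope.

(** A relation is given by its values on environments, uniformly in the group.
    A formula may place the arguments of the relation in the variables [r i] of
    its choice, as long as infinitely many variables remain available for
    quantifiers: since the definition asks for a formula for every such [r],
    relations can be quantified without renaming bound variables. *)
Definition coinfinite (r : nat -> nat) :=
  forall N, exists2 y, N <= y & forall i, r i <> y.

Definition definable (P : forall G : groupType, (nat -> G) -> Prop) :=
  forall r, coinfinite r -> exists phi : formula group_language,
    forall (G : groupType) (e : nat -> G),
      holds (M := group_structure G) e phi <-> P G (fun i => e (r i)).

Definition is_term (t : forall G : groupType, (nat -> G) -> G) :=
  forall r : nat -> nat, exists u : term group_language,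
    forall (G : groupType) (e : nat -> G),
      eval (M := group_structure G) e u = t G (fun i => e (r i)).

Lemma is_term_var k : is_term (fun G e => e k).
Proof. by move=> r; exists (Var _ (r k)). Qed.

Lemma is_term_one : is_term (fun G e => 1).
Proof. by move=> r; exists (App (s := GOne : Defs.fsym group_language) (fun=> Var _ 0)). Qed.

Lemma is_term_inv t : is_term t -> is_term (fun G e => (t G e)^-1).
Proof.
move=> tP r; have [u uP] := tP r.
by exists (App (s := GInv : Defs.fsym group_language) (fun=> u)) => G e /=; rewrite uP.
Qed.

Lemma is_term_mul t u :
  is_term t -> is_term u -> is_term (fun G e => t G e * u G e).
Proof.
move=> tP uP r; have [t' t'P] := tP r; have [u' u'P] := uP r.
exists (App (s := GMul : Defs.fsym group_language)
  (fun i : 'I_2 => if i == ord0 then t' else u')) => G e /=.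
by rewrite t'P u'P.
Qed.

Lemma is_term_comm t u :
  is_term t -> is_term u -> is_term (fun G e => [~ t G e, u G e]).
Proof.
move=> tP uP; rewrite /commg /conjg.
apply: (@is_term_mul (fun G e => _) (fun G e => _)); first exact: is_term_inv.
apply: (@is_term_mul (fun G e => _) (fun G e => _)); first exact: is_term_inv.
exact: is_term_mul.
Qed.

Lemma is_term_prod (I : Type) (r : seq I) t :
  (forall i, is_term (t i)) -> is_term (fun G e => \prod_(i <- r) t i G e).
Proof.
move=> tP; elim: r => [|i r IHr] s.
  by have [u uP] := is_term_one s; exists u => G e; rewrite uP big_nil.
have [u uP] := is_term_mul (tP i) IHr s.
by exists u => G e; rewrite uP big_cons.
Qed.

Lemma definable_ext P Q :
  (forall G e, P G e <-> Q G e) -> definable P -> definable Q.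
Proof.
by move=> PQ dP r rc; have [phi phiP] := dP r rc; exists phi => G e; rewrite phiP PQ.
Qed.

Lemma definable_eq t u :
  is_term t -> is_term u -> definable (fun G e => t G e = u G e).
Proof.
move=> tP uP r _; have [t' t'P] := tP r; have [u' u'P] := uP r.
by exists (Equal t' u') => G e /=; rewrite t'P u'P.
Qed.

Lemma definable_not P : definable P -> definable (fun G e => ~ P G e).
Proof.
by move=> dP r rc; have [p pP] := dP r rc; exists (Not p) => G e /=; rewrite pP.
Qed.

Lemma definable_and P Q :
  definable P -> definable Q -> definable (fun G e => P G e /\ Q G e).
Proof.
move=> dP dQ r rc; have [p pP] := dP r rc; have [q qP] := dQ r rc.
by exists (And p q) => G e /=; rewrite pP qP.
Qed.

Lemma definable_and3 P Q S :
  definable P -> definable Q -> definable S ->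
  definable (fun G e => [/\ P G e, Q G e & S G e]).
Proof.
move=> dP dQ dS; apply: (definable_ext _ (definable_and dP (definable_and dQ dS))).
by move=> G e; split=> [[? [? ?]]|[]].
Qed.

Lemma definable_and5 P Q S T U :
  definable P -> definable Q -> definable S -> definable T -> definable U ->
  definable (fun G e => [/\ P G e, Q G e, S G e, T G e & U G e]).
Proof.
move=> dP dQ dS dT dU.
apply: (definable_ext _ (definable_and (definable_and3 dP dQ dS) (definable_and dT dU))).
by move=> G e; split=> [[[? ? ?] [? ?]]|[]].
Qed.

Lemma definable_or P Q :
  definable P -> definable Q -> definable (fun G e => P G e \/ Q G e).
Proof.
move=> dP dQ r rc; have [p pP] := dP r rc; have [q qP] := dQ r rc.
by exists (Or p q) => G e /=; rewrite pP qP.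
Qed.

Lemma definable_imp P Q :
  definable P -> definable Q -> definable (fun G e => P G e -> Q G e).
Proof.
move=> dP dQ r rc; have [p pP] := dP r rc; have [q qP] := dQ r rc.
by exists (Defs.Implies p q) => G e /=; rewrite pP qP.
Qed.

Lemma definable_True : definable (fun G e => True).
Proof.
apply: (@definable_ext (fun G e => 1 = 1 :> G)) => //.
by apply: definable_eq => //; apply: is_term_one.
Qed.

(** The bound variable [y] of a quantifier is taken outside the range of [r],
    and infinitely many variables are still unused afterwards. *)
Lemma coinfinite_fresh r : coinfinite r ->
  exists y, [/\ forall i, r i <> y &
    coinfinite (fun i => if i is j.+1 then r j else y)].
Proof.
move=> rc; have [y _ ry] := rc 0; exists y; split=> // N.
have [z zN rz] := rc (maxn N y.+1); exists z.
  by apply: leq_trans zN; rewrite leq_maxl.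
by case=> // yz; move: zN; rewrite -yz geq_max ltnn andbF.
Qed.

Lemma definable_forall (P : forall G : groupType, (nat -> G) -> G -> Prop) :
  definable (fun G e => P G (fun i => e i.+1) (e 0)) ->
  definable (fun G e => forall m, P G e m).
Proof.
move=> dP r /coinfinite_fresh[y [ry rc]].
have [p pP] := dP _ rc; exists (Forall y p) => G e /=.
have E m : (fun i => update (M := group_structure G) e y m (r i)) = (fun i => e (r i)).
  by apply/funext => i; rewrite /update; case: eqP => // /ry.
by split=> H m; move: (H m); rewrite pP E /update eqxx.
Qed.

Lemma definable_exists (P : forall G : groupType, (nat -> G) -> G -> Prop) :
  definable (fun G e => P G (fun i => e i.+1) (e 0)) ->
  definable (fun G e => exists m, P G e m).
Proof.
move=> dP; apply: (@definable_ext (fun G e => ~ forall m, ~ P G e m)).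
  move=> G e; split=> [|[m Pm] H]; last exact: H Pm.
  by apply: contra_notP => H m Pm; apply: H; exists m.
by apply/definable_not/definable_forall/definable_not.
Qed.

(** The case of one quantifier is iterated [#|T|] times: at each step the last
    of the first [n.+1] variables is bound. *)
Lemma definable_forall_fun (T : finType)
    (P : forall G : groupType, (nat -> G) -> (T -> G) -> Prop) :
  definable (fun G e => P G (fun i => e (#|T| + i)) (fun t => e (enum_rank t))) ->
  definable (fun G e => forall b, P G e b).
Proof.
suff H n (Q : forall G : groupType, (nat -> G) -> (nat -> G) -> Prop) :
    (forall G e b b', (forall i, i < n -> b i = b' i) -> Q G e b -> Q G e b') ->
    definable (fun G e => Q G (fun i => e (n + i)) e) ->
    definable (fun G e => forall b, Q G e b).
  move=> dP.
  apply: (@definable_ext (fun G e => forall b : nat -> G, P G e (fun t => b (enum_rank t)))).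
    move=> G e; split=> [Pe b|Pe b]; last exact: Pe.
    pose b' k := if insub k is Some i then b (enum_val (i : 'I_#|T|)) else 1.
    rewrite (_ : b = (fun t : T => b' (enum_rank t))); first exact: Pe.
    by apply/funext => t; rewrite /b' valK enum_rankK.
  apply: (H #|T|) => // G e b b' bb'.
  rewrite (_ : (fun t => b _) = (fun t : T => b' (enum_rank t))) //.
  by apply/funext => t; apply: bb'.
move: Q; elim: n => [|n IHn] Q Qext dQ.
  apply: (@definable_ext (fun G e => Q G e e)) => [G e|//].
  by split=> [H b|]; [apply: Qext H|apply].
pose Q' G e b := forall m, Q G e (fun k => if k == n then m else b k).
apply: (@definable_ext (fun G e => forall b, Q' G e b)).
  move=> G e; split=> H b; last by move=> m; exact: H.
  by apply: Qext (H b (b n)) => i _; case: eqP => // ->.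
apply: IHn => [G e b b' bb' H m|].
  by apply: Qext (H m) => i; rewrite ltnS; case: eqP => // /eqP ni i_n; apply: bb'; rewrite ltn_neqAle ni.
rewrite /Q'.
(* [m] has to be inserted as the variable number [n] instead of number 0 as in
   [definable_forall], so the placement of the variables is made by hand *)
move=> r /coinfinite_fresh[y [ry rc]].
pose r' k := if k < n then r k else if k == n then y else r k.-1.
have rc' : coinfinite r'.
  move=> N; have [z zN rz] := rc N; exists z => // k; rewrite /r'.
  by case: ifP => _; [apply: (rz k.+1)|case: ifP => _; [apply: (rz 0)|apply: (rz k.-1.+1)]].
have [p pP] := dQ _ rc'; exists (Forall y p) => G e /=.
have E1 m : (fun i => update (M := group_structure G) e y m (r' (n.+1 + i))) = (fun i => e (r (n + i))).
  apply/funext => i; rewrite /r' /update addSn ltnNge (leq_trans (leq_addr i n) (leqnSn _)) /=.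
  have -> : ((n + i).+1 == n) = false by apply: gtn_eqF; rewrite ltnS leq_addr.
  by case: eqP => [rE|]; [case: (ry _ rE)|].
have E2 m i : i < n.+1 -> update (M := group_structure G) e y m (r' i) =
    (if i == n then m else e (r i)).
  rewrite ltnS leq_eqVlt /update /r'; case: eqP => [-> _|_ /= ->]; last by case: eqP => // rE; case: (ry _ rE).
  by rewrite ltnn eqxx.
split=> H m; first by have /pP := H m; rewrite E1; apply: Qext => i /E2.
by apply/pP; rewrite E1; apply: Qext (H m) => i /E2.
Qed.

Lemma definable_exists_fun (T : finType)
    (P : forall G : groupType, (nat -> G) -> (T -> G) -> Prop) :
  definable (fun G e => P G (fun i => e (#|T| + i)) (fun t => e (enum_rank t))) ->
  definable (fun G e => exists b, P G e b).
Proof.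
move=> dP; apply: (@definable_ext (fun G e => ~ forall b, ~ P G e b)).
  move=> G e; split=> [|[m Pm] H]; last exact: H Pm.
  by apply: contra_notP => H m Pm; apply: H; exists m.
by apply/definable_not/definable_forall_fun/definable_not.
Qed.

Lemma definable_fin (T : finType) (P : T -> forall G : groupType, (nat -> G) -> Prop) :
  (forall t, definable (P t)) -> definable (fun G e => forall t, P t G e).
Proof.
move=> dP.
have H (s : seq T) : definable (fun G e => forall t, t \in s -> P t G e).
  elim: s => [|t s IHs].
    by apply: (definable_ext _ definable_True) => G e; split.
  apply: (definable_ext _ (definable_and (dP t) IHs)) => G e; split=> [[Pt Ps] u|H].
    by rewrite inE => /orP[/eqP->|/Ps].
  by split=> [|u us]; apply: H; rewrite inE ?eqxx ?us ?orbT.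
apply: (definable_ext _ (H (enum T))) => G e; split=> Ps t; last by move=> _.
by apply: Ps; rewrite mem_enum.
Qed.

(** The condition [c] does not concern the group, so it need not be expressed
    by a formula: it selects which formula to take. *)
Lemma definable_guard (c : bool) P :
  (c -> definable P) -> definable (fun G e => c -> P G e).
Proof.
case: c => [/(_ isT)dP|_]; first by apply: (definable_ext _ dP) => G e; split=> // H; apply: H.
by apply: (definable_ext _ definable_True) => G e; split.
Qed.

Lemma definable_if (c : bool) P Q :
  definable P -> definable Q -> definable (fun G e => if c then P G e else Q G e).
Proof. by case: c. Qed.

(** Even variables leave infinitely many unused ones; closing the resulting
    formula gives a sentence, to which elementary equivalence applies. *)
Lemma definable_transfer (P : groupType -> Prop) (G H : groupType) :
  definable (fun K _ => P K) ->
  elementarily_equivalent (group_structure H) (group_structure G) -> P G -> P H.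
Proof.
move=> dP HG PG.
have [|phi phiP] := dP (fun i => i.*2).
  move=> N; exists N.*2.+1 => [|i]; first by rewrite -addnn leqW ?leq_addr.
  by move/(congr1 odd); rewrite /= !odd_double.
have [psi spsi psiP] := closed_formula phi.
have psiE K : models (group_structure K) psi <-> P K.
  by apply: psiP; [split; exact: (1 : K)|exact: phiP].
by apply/psiE; rewrite HG //; apply/psiE.
Qed.

End Definability.

(** * Frames *)

Section Frames.
Local Open Scope group_scope.
Variable m : nat.
Local Notation n := m.+2.
Local Notation i0 := (ord0 : 'I_n).
Local Notation i1 := (Ordinal (isT : (1 < n)%N) : 'I_n).

Definition central (K : groupType) (z : K) := forall x, commute z x.

(** The order of the factors is the one for which multiplying two such products
    contributes the commutators of the [i]-th factor of the first one with the
    [j]-th factor of the second one for [i < j], as the terms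
    [u.1 i * v.1 j] do in the group law of [N2]. *)
Definition prod_desc (K : groupType) k (c : 'I_k -> K) := \prod_(i <- rev (enum 'I_k)) c i.

Section Coordinates.
Variables (K : groupType) (b : 'I_n -> K).

(** Modulo the center, this is the [i]-th axis. *)
Definition cent i x := commute x (b i).

(** For the generators of the integral group and elements [x0] and [x] with
    coordinates [k] and [l] on the axes of index [i0] and [i], the two
    commutators are the powers of [[~ b i0, b i]] with exponents [k] and [l].
    They are of no use when [i = i0], where both are trivial. *)
Definition same_coef i x0 x := if i == i0 then x0 = x else [~ x0, b i] = [~ b i0, x].

(** In the integral group, the coordinate [k] is represented by the power of
    [[~ b i0, b i1]] with exponent [k]. This is a group element and not just a
    class modulo the center, so equality of scalars is equality in the group. *)
Definition scalar g := exists x, cent i0 x /\ g = [~ x, b i1].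

(** The graph of the coordinate map from the [i]-th axis to the scalars. *)
Definition coef i x g :=
  cent i x /\ exists x0, [/\ cent i0 x0, same_coef i x0 x & g = [~ x0, b i1]].

Definition scalar_mul g h k := exists x y,
  [/\ cent i0 x, cent i1 y, [~ x, b i1] = g, [~ b i0, y] = h & [~ x, y] = k].

(** These conditions are chosen to be first-order in [b], to hold for the
    generators of the integral group, and to suffice for building coordinates.
    In [frame_comm] the commutator [[~ b i, y']] stands for the scalar [k] in
    the summand of index [(i, j)] of the center. *)
Record frame : Prop := Frame {
  frame_class2 : forall x y : K, central [~ x, y];
  frame_abelian : forall i x y, cent i x -> cent i y -> commute x y;
  frame_span : forall h, exists c, (forall i, cent i (c i)) /\ h = prod_desc c;
  frame_free : forall c, (forall i, cent i (c i)) -> central (prod_desc c) ->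
    forall i, central (c i);
  frame_disjoint : forall i : 'I_n, i != i0 -> forall x, cent i0 x -> cent i x -> central x;
  frame_coef : forall i x, cent i x -> exists x0, cent i0 x0 /\ same_coef i x0 x;
  frame_coef_surj : forall i x0, cent i0 x0 -> exists x, cent i x /\ same_coef i x0 x;
  frame_mul : forall x y, cent i0 x -> cent i1 y -> scalar [~ x, y];
  frame_mulA : forall g1 g2 g3 h h' k k',
    scalar_mul g1 g2 h -> scalar_mul h g3 k ->
    scalar_mul g2 g3 h' -> scalar_mul g1 h' k' -> k = k';
  frame_comm : forall i j : 'I_n, (i < j)%N -> forall x y y' g h k,
    coef i x g -> coef j y h -> scalar_mul g h k -> coef j y' k ->
    [~ x, y] = [~ b i, y'];
  frame_center : forall z, central z -> exists y : opair n -> K,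
    (forall p, cent (val p).2 (y p)) /\ z = \prod_p [~ b (val p).1, y p];
  frame_center_free : forall y : opair n -> K, (forall p, cent (val p).2 (y p)) ->
    \prod_p [~ b (val p).1, y p] = 1 -> forall p, central (y p)
}.

(** The evaluation of ring terms and formulas among the scalars is stated with
    relations because the product of scalars is only given by its graph. No
    ring structure is assumed, so that the translation makes sense for any [b]
    and is visibly a formula of the language of groups. *)
Fixpoint scalar_value (e : nat -> K) (t : term ring_language) (g : K) : Prop :=
  match t with
  | Var x => g = e x
  | App s a =>
    match s as s0 return ('I_(@arity ring_language s0) -> K -> Prop) -> Prop with
    | RZero => fun _ => g = 1
    | ROne => fun _ => g = [~ b i0, b i1]
    | ROpp => fun v => exists h, v ord0 h /\ g = h^-1
    | RAdd => fun v => exists h k, v ord0 h /\ v ord_max k /\ g = h * k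
    | RMul => fun v => exists h k, v ord0 h /\ v ord_max k /\ scalar_mul h k g
    end (fun i => scalar_value e (a i))
  end.

Fixpoint scalar_holds (e : nat -> K) (phi : formula ring_language) : Prop :=
  match phi with
  | Equal t u => exists g, scalar_value e t g /\ scalar_value e u g
  | Not p => ~ scalar_holds e p
  | And p q => scalar_holds e p /\ scalar_holds e q
  | Or p q => scalar_holds e p \/ scalar_holds e q
  | Defs.Implies p q => scalar_holds e p -> scalar_holds e q
  | Forall x p => forall g, scalar g -> scalar_holds (fun y => if y == x then g else e y) p
  | Exists x p => exists g, scalar g /\ scalar_holds (fun y => if y == x then g else e y) p
  end.

End Coordinates.

Ltac unfold_definable :=
  rewrite /coef /scalar_mul /scalar /same_coef /cent /central /commute /prod_desc.
Ltac definability1 := lazymatch goal with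
  | |- is_term (fun G e => e _) => apply: is_term_var
  | |- is_term (fun G e => 1) => apply: is_term_one
  | |- is_term (fun G e => [~ @?t G e, @?u G e]) => refine (@is_term_comm t u _ _)
  | |- is_term (fun G e => @?t G e * @?u G e) => refine (@is_term_mul t u _ _)
  | |- is_term (fun G e => (@?t G e)^-1) => refine (@is_term_inv t _)
  | |- is_term (fun G e => \prod_(i <- _) _) =>
      refine (@is_term_prod _ _ (fun i G e => _) _); move=> ?
  | |- definable (fun G e => @?t G e = @?u G e) => refine (@definable_eq t u _ _)
  | |- definable (fun G e => and5 (@?P G e) (@?Q G e) (@?R G e) (@?S G e) (@?T G e)) =>
      refine (@definable_and5 P Q R S T _ _ _ _ _)
  | |- definable (fun G e => and3 (@?P G e) (@?Q G e) (@?R G e)) =>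
      refine (@definable_and3 P Q R _ _ _)
  | |- definable (fun G e => and (@?P G e) (@?Q G e)) => refine (@definable_and P Q _ _)
  | |- definable (fun G e => or (@?P G e) (@?Q G e)) => refine (@definable_or P Q _ _)
  | |- definable (fun G e => ~ @?P G e) => refine (@definable_not P _)
  | |- definable (fun G e => is_true _ -> @?P G e) =>
      refine (@definable_guard _ P _); move=> ?
  | |- definable (fun G e => @?P G e -> @?Q G e) => refine (@definable_imp P Q _ _)
  | |- definable (fun G e => exists m : _ -> _, _) =>
      refine (@definable_exists_fun _ (fun G e m => _) _)
  | |- definable (fun G e => exists m, _) => refine (@definable_exists (fun G e m => _) _)
  | |- definable (fun G e => forall m : _ -> _, _) =>
      refine (@definable_forall_fun _ (fun G e m => _) _)
  | |- definable (fun G e => forall m, _) =>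
     first [ refine (@definable_forall (fun G e m => _) _)
           | refine (@definable_fin _ (fun i G e => _) _); move=> ? ]
  | |- definable _ => refine (@definable_if _ (fun G e => _) (fun G e => _) _ _)
  end.
Ltac definability := unfold_definable; repeat (definability1; cbv beta).

Lemma definable_frame (v : 'I_n -> nat) :
  definable (fun G e => frame (fun i => e (v i))).
Proof.
pose C (G : groupType) (b : 'I_n -> G) := [/\
  (forall x y : G, central [~ x, y]) /\
  (forall i x y, cent b i x -> cent b i y -> commute x y),
  (forall h, exists c, (forall i, cent b i (c i)) /\ h = prod_desc c) /\
  (forall c, (forall i, cent b i (c i)) -> central (prod_desc c) ->
    forall i, central (c i)),
  (forall i : 'I_n, i != i0 -> forall x, cent b i0 x -> cent b i x -> central x) /\
  (forall i x, cent b i x -> exists x0, cent b i0 x0 /\ same_coef b i x0 x) /\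
  (forall i x0, cent b i0 x0 -> exists x, cent b i x /\ same_coef b i x0 x),
  (forall x y, cent b i0 x -> cent b i1 y -> scalar b [~ x, y]) /\
  (forall g1 g2 g3 h h' k k',
    scalar_mul b g1 g2 h -> scalar_mul b h g3 k ->
    scalar_mul b g2 g3 h' -> scalar_mul b g1 h' k' -> k = k') /\
  (forall i j : 'I_n, (i < j)%N -> forall x y y' g h k,
    coef b i x g -> coef b j y h -> scalar_mul b g h k -> coef b j y' k ->
    [~ x, y] = [~ b i, y']) &
  (forall z, central z -> exists y : opair n -> G,
    (forall p, cent b (val p).2 (y p)) /\ z = \prod_p [~ b (val p).1, y p]) /\
  (forall y : opair n -> G, (forall p, cent b (val p).2 (y p)) ->
    \prod_p [~ b (val p).1, y p] = 1 -> forall p, central (y p))].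
apply: (@definable_ext (fun G e => C G (fun i => e (v i)))).
  move=> G e; split=> [[[? ?] [? ?] [? [? ?]] [? [? ?]] [? ?]]|[*]]; by [constructor|split].
by rewrite /C; definability.
Qed.

Lemma definable_scalar_value t : forall (v : 'I_n -> nat) (r : nat -> nat) (k : nat),
  definable (fun G e => scalar_value (fun i => e (v i)) (fun x => e (r x)) t (e k)).
Proof.
elim: t => [x|[] a IHa] v r k /=; definability; exact: IHa.
Qed.

Lemma definable_scalar_holds phi : forall (v : 'I_n -> nat) (r : nat -> nat),
  definable (fun G e => scalar_holds (fun i => e (v i)) (fun x => e (r x)) phi).
Proof.
elim: phi => [t u|p IHp|p IHp q IHq|p IHp q IHq|p IHp q IHq|x p IHp|x p IHp] v r /=.
- definability; exact: definable_scalar_value.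
- by definability; apply: IHp.
- by definability; [apply: IHp|apply: IHq].
- by definability; [apply: IHp|apply: IHq].
- by definability; [apply: IHp|apply: IHq].
- definability.
  apply: definable_ext (IHp (fun i => (v i).+1) (fun y => if y == x then 0 else (r y).+1)) => G e.
  by rewrite (_ : (fun y => e _) = (fun y => if y == x then e 0 else e (r y).+1)) //; apply/funext => y; case: eqP.
- definability.
  apply: definable_ext (IHp (fun i => (v i).+1) (fun y => if y == x then 0 else (r y).+1)) => G e.
  by rewrite (_ : (fun y => e _) = (fun y => if y == x then e 0 else e (r y).+1)) //; apply/funext => y; case: eqP.
Qed.

Lemma definable_has_frame :
  definable (fun G _ => exists b : 'I_n -> G, frame b).
Proof.
definability; exact: (@definable_frame (fun i => enum_rank i)).
Qed.

Lemma definable_all_scalar_rings phi :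
  definable (fun G _ => forall b : 'I_n -> G, frame b -> scalar_holds b (fun=> 1) phi).
Proof.
(* the constant environment is obtained by placing all ring variables in one
   group variable [u], required to be 1 *)
apply: (@definable_ext (fun G _ => forall (b : 'I_n -> G) (u : G),
    u = 1 -> frame b -> scalar_holds b (fun=> u) phi)).
  by move=> G _; split=> [H b|H b u -> //]; apply: H.
definability.
  exact: (@definable_frame (fun i => (enum_rank i).+1)).
exact: (@definable_scalar_holds phi (fun i => (enum_rank i).+1) (fun=> 0)).
Qed.

End Frames.

(** * Groups of class two *)

Lemma bijective_of_inj_surj (T U : Type) (f : T -> U) :
  injective f -> (forall y, exists x, f x = y) -> bijective f.
Proof.
move=> fI fS; have [g gK] := choice fS.
by exists g => // x; apply: fI; rewrite gK.
Qed.

Lemma isomorphic_of_morph (G H : groupType) (f : G -> H) :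
  {morph f : x y / (x * y)%g} -> bijective f -> isomorphic G H.
Proof.
move=> fM fB.
pose F : {multiplicative G -> H} := HB.pack f (isMultiplicative.Build G H f fM).
by exists F.
Qed.

Lemma isomorphic_sym (G H : groupType) : isomorphic G H -> isomorphic H G.
Proof.
move=> [f [g fK gK]]; apply: (@isomorphic_of_morph _ _ g); last by exists f.
by move=> x y; apply: (can_inj fK); rewrite gmulfM !gK.
Qed.

Section Central.
Local Open Scope group_scope.
Variable K : groupType.
Implicit Types x y z : K.

Lemma central1 : central (1 : K).
Proof. by move=> x; rewrite /commute mul1g mulg1. Qed.

Lemma centralM x y : central x -> central y -> central (x * y).
Proof. by move=> cx cy z; rewrite /commute -mulgA (cy z) mulgA (cx z) mulgA. Qed.

Lemma centralV x : central x -> central x^-1.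
Proof. by move=> cx z; apply/commute_sym/commuteV/commute_sym. Qed.

Lemma central_prod (I : Type) (r : seq I) (F : I -> K) :
  (forall i, central (F i)) -> central (\prod_(i <- r) F i).
Proof. by move=> cF; apply: (big_ind (@central K) central1 centralM). Qed.

Lemma prodM_central (I : eqType) (r : seq I) (F E : I -> K) :
  (forall i, central (E i)) ->
  \prod_(i <- r) (F i * E i) = \prod_(i <- r) F i * \prod_(i <- r) E i.
Proof.
by move=> cE; apply: prodgM_commute => i j _ _; apply/commute_sym/cE.
Qed.

Hypothesis K2 : forall x y, central [~ x, y].

Lemma commgMl x y z : [~ x * y, z] = [~ x, z] * [~ y, z].
Proof.
move: (commgC (x * y) z) (commgC y z) (commgC x z) (K2 x z y).
move: [~ x * y, z] [~ y, z] [~ x, z] => u v w xyz yz xz wy.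
by apply: (@mulgI _ (z * (x * y))); rewrite -xyz -mulgA yz !mulgA xz -!mulgA (mulgA w) wy !mulgA.
Qed.

Lemma commgMr x y z : [~ x, y * z] = [~ x, y] * [~ x, z].
Proof.
by rewrite -[LHS]invgR commgMl invgM !invgR K2.
Qed.

Lemma commg_central_l x y : central x -> [~ x, y] = 1.
Proof. by move=> cx; apply/eqP/commgP. Qed.

Lemma commg_central_r x y : central y -> [~ x, y] = 1.
Proof. by move=> cy; apply/eqP/commgP/commute_sym. Qed.

Lemma commgVl x y : [~ x^-1, y] = [~ x, y]^-1.
Proof. by apply: (@mulIg _ [~ x, y]); rewrite mulVg -commgMl mulVg comm1g. Qed.

Lemma commgVr x y : [~ x, y^-1] = [~ x, y]^-1.
Proof. by apply: (@mulIg _ [~ x, y]); rewrite mulVg -commgMr mulVg commg1. Qed.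

Lemma commg_congl x y z : central (x^-1 * y) -> [~ x, z] = [~ y, z].
Proof. by move=> c; rewrite -(mulVKg x y) commgMl (commg_central_l _ c) mulg1. Qed.

Lemma commg_congr x y z : central (x^-1 * y) -> [~ z, x] = [~ z, y].
Proof. by move=> c; rewrite -(mulVKg x y) commgMr (commg_central_r _ c) mulg1. Qed.

Lemma commg_prodl (I : Type) (r : seq I) (F : I -> K) z :
  [~ \prod_(i <- r) F i, z] = \prod_(i <- r) [~ F i, z].
Proof.
by elim: r => [|i r IHr]; rewrite ?big_nil ?comm1g // !big_cons commgMl IHr.
Qed.

(** Collecting the product of two decreasing products moves each [d j] to the
    left, past the [c i] with [i < j] only, and every such move contributes a
    central commutator. Applied with [s] a parametrization of the center, this
    is the origin of the terms [u.1 i * v.1 j] of the group law of [N2]. *)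
Lemma prodM_class2 (V : zmodType) (s : V -> K) k (c d : 'I_k -> K)
    (q : 'I_k -> 'I_k -> V) (l : seq 'I_k) :
    {morph s : u v / (u + v)%R >-> u * v} -> (forall v, central (s v)) ->
    (forall i j : 'I_k, (i < j)%N -> [~ c i, d j] = s (q i j)) ->
    pairwise (fun i j : 'I_k => (j < i)%N) l ->
  \prod_(i <- l) c i * \prod_(i <- l) d i =
  \prod_(i <- l) (c i * d i) * s (\sum_(j <- l) \sum_(i <- l | (i < j)%N) q i j)%R.
Proof.
move=> sD sZ cd.
have s0 : s 0%R = 1 by apply: (@mulgI _ (s 0%R)); rewrite -sD addr0 mulg1.
elim: l => [|j l IHl]; first by rewrite !big_nil s0 !mulg1.
rewrite /= => /andP[/allP jl /IHl{}IHl].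
have -> : (\sum_(j' <- j :: l) \sum_(i <- j :: l | (i < j')%N) q i j' =
    \sum_(i <- l) q i j + \sum_(j' <- l) \sum_(i <- l | (i < j')%N) q i j')%R.
  rewrite big_cons big_cons ltnn; congr (_ + _)%R.
    rewrite [RHS]big_seq [LHS]big_seq_cond; apply: eq_bigl => i.
    by case il: (i \in l) => //=; apply: jl.
  rewrite [RHS]big_seq [LHS]big_seq; apply: eq_bigr => i il.
  by rewrite big_cons ltnNge (ltnW (jl _ il)).
have qE : s (\sum_(i <- l) q i j)%R = [~ \prod_(i <- l) c i, d j].
  rewrite commg_prodl (big_morph s sD s0).
  by rewrite [LHS]big_seq [RHS]big_seq; apply: eq_bigr => i il; rewrite -cd //; apply: jl.
have := commgC (\prod_(i <- l) c i) (d j); rewrite !big_cons sD -qE.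
have := sZ (\sum_(i <- l) q i j)%R.
move: IHl; move: (s _) (s _) (\prod_(i <- l) c i) (\prod_(i <- l) d i)
  (\prod_(i <- l) (c i * d i)) => u v C D E CD vZ Cd.
rewrite (vZ v) mulgA -(mulgA _ C) Cd !mulgA -[X in X = _]mulgA (vZ D).
by rewrite mulgA -(mulgA _ C D) CD !mulgA.
Qed.

End Central.

Definition pair_delta (V : zmodType) k (i j : 'I_k) (v : V) : {ffun opair k -> V} :=
  [ffun p => if val p == (i, j) then v else 0%R].

Lemma pairwise_rev_enum k : pairwise (fun i j : 'I_k => (j < i)%N) (rev (enum 'I_k)).
Proof.
rewrite -sorted_pairwise => [|i j k' /= ij jk]; last exact: ltn_trans jk ij.
rewrite rev_sorted; have := iota_ltn_sorted 0 k; rewrite -val_enum_ord sorted_map.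
by [].
Qed.

Lemma sum_pair_delta (V : zmodType) k (a : 'I_k -> 'I_k -> V) :
  (\sum_(j <- rev (enum 'I_k)) \sum_(i <- rev (enum 'I_k) | (i < j)%N)
     pair_delta i j (a i j) = [ffun p => a (val p).1 (val p).2])%R.
Proof.
have E (P : pred 'I_k) (F : 'I_k -> {ffun opair k -> V}) :
    (\sum_(i <- rev (enum 'I_k) | P i) F i = \sum_(i | P i) F i)%R.
  by rewrite (perm_big (enum 'I_k)) ?big_enum_cond //= perm_rev.
rewrite E; apply/ffunP => p; rewrite sum_ffunE ffunE.
under eq_bigr => j _ do rewrite E sum_ffunE.
rewrite (bigD1 (val p).2) //= [X in (_ + X)%R]big1 ?addr0 => [|j jp]; last first.
  rewrite big1 // => i _; rewrite ffunE; case: eqP => // pE.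
  by rewrite pE eqxx in jp.
rewrite (bigD1 (val p).1) ?(valP p) //= big1 ?addr0 => [|i /andP[_ ip]]; last first.
  rewrite ffunE; case: eqP => // pE.
  by rewrite pE eqxx in ip.
by rewrite ffunE -surjective_pairing eqxx.
Qed.

Lemma sum_pair_delta_coord (V : zmodType) k (v : {ffun opair k -> V}) :
  (\sum_p pair_delta (val p).1 (val p).2 (v p) = v)%R.
Proof.
apply/ffunP => q; rewrite sum_ffunE (bigD1 q) //= big1 ?addr0 => [|p pq].
  by rewrite ffunE -surjective_pairing eqxx.
rewrite ffunE; case: eqP => // qE; case/eqP: pq.
by apply: val_inj; rewrite qE -surjective_pairing.
Qed.

(** * The ring of scalars of a frame *)

Section ScalarRing.
Local Open Scope group_scope.
Variable m : nat.
Local Notation n := m.+2.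
Local Notation i0 := (ord0 : 'I_n).
Local Notation i1 := (Ordinal (isT : (1 < n)%N) : 'I_n).
Variables (K : groupType) (b : 'I_n -> K).
Implicit Types (x y z g h : K) (i j : 'I_n).

Lemma cent1 i : cent b i 1.
Proof. exact/commute_sym/commute1. Qed.

Lemma centM i x y : cent b i x -> cent b i y -> cent b i (x * y).
Proof. by move=> cx cy; apply/commute_sym/commuteM; apply/commute_sym. Qed.

Lemma centV i x : cent b i x -> cent b i x^-1.
Proof. by move=> cx; apply/commute_sym/commuteV/commute_sym. Qed.

Lemma cent_central i x : central x -> cent b i x.
Proof. by move=> cx; apply: cx. Qed.

Lemma cent_frame i : cent b i (b i).
Proof. exact: commute_refl. Qed.

Hypothesis Fb : frame b.
Let K2 := frame_class2 Fb.

Lemma coef_scalar i x g : coef b i x g -> scalar b g.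
Proof. by move=> [_ [x0 [c0 _ ->]]]; exists x0. Qed.

Lemma scalar_central g : scalar b g -> central g.
Proof. by move=> [x [_ ->]]; apply: K2. Qed.

Lemma coef_exists i x : cent b i x -> exists g, coef b i x g.
Proof.
move=> cx; have [x0 [c0 s0]] := frame_coef Fb cx.
by exists [~ x0, b i1]; split=> //; exists x0.
Qed.

Lemma coef_onto i g : scalar b g -> exists x, coef b i x g.
Proof.
move=> [x0 [c0 ->]]; have [x [cx sx]] := frame_coef_surj Fb i c0.
by exists x; split=> //; exists x0.
Qed.

Lemma coefM i x y g h :
  coef b i x g -> coef b i y h -> coef b i (x * y) (g * h).
Proof.
move=> [cx [x0 [cx0 sx ->]]] [cy [y0 [cy0 sy ->]]]; split; first exact: centM.
exists (x0 * y0); split; [exact: centM| |by rewrite commgMl].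
move: sx sy; rewrite /same_coef; case: eqP => _ sx sy; first by rewrite sx sy.
by rewrite commgMl // commgMr // sx sy.
Qed.

Lemma coefV i x g : coef b i x g -> coef b i x^-1 g^-1.
Proof.
move=> [cx [x0 [cx0 sx ->]]]; split; first exact: centV.
exists x0^-1; split; [exact: centV| |by rewrite commgVl].
move: sx; rewrite /same_coef; case: eqP => _ sx; first by rewrite sx.
by rewrite commgVl // commgVr // sx.
Qed.

Lemma coef_central i z : central z -> coef b i z 1.
Proof.
move=> cz; split; first exact: cent_central.
have [ii|ii] := eqVneq i i0.
  by exists z; split; [apply: cent_central|rewrite /same_coef ii|rewrite commg_central_l].
exists 1; split; [exact: cent1| |by rewrite comm1g].
by rewrite /same_coef (negbTE ii) comm1g commg_central_r.
Qed.

(** If the coordinate of [z] vanishes, the element [x0] of the axis [0] with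
    the same coordinate commutes with [b i1], so it is central as an element of
    two axes; then [z] commutes with [b i0] and is central for that reason. *)
Lemma coef_is_central i z : coef b i z 1 -> central z.
Proof.
move=> [cz [x0 [cx0 sx /esym/eqP/commgP]]].
move=> /(frame_disjoint Fb (isT : i1 != i0) cx0) c0; move: sx.
rewrite /same_coef; case: eqP => [_ <- //|/eqP ii].
rewrite commg_central_l // => /esym/eqP/commgP/commute_sym cz0.
exact: (frame_disjoint Fb ii).
Qed.

(** It suffices that the coordinate of [1] is unique, since coordinates are
    additive. *)
Lemma coef_fun i x g h : coef b i x g -> coef b i x h -> g = h.
Proof.
move=> xg /coefV xh; move: (coefM xg xh); rewrite mulgV => -[_ [x0 [c0 s0 gE]]].
apply: divg1_eq; rewrite gE; apply/eqP/commgP.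
move: s0; rewrite /same_coef; case: eqP => [_ -> |/eqP ii]; first exact: cent1.
rewrite commg1 => /eqP/commgP x0i.
exact: (frame_disjoint Fb ii c0 x0i).
Qed.

Lemma coef_inj i x y g : coef b i x g -> coef b i y g -> central (x^-1 * y).
Proof.
by move=> /coefV xg yg; apply: (@coef_is_central i); rewrite -(mulVg g); apply: coefM.
Qed.

Lemma coef_i0 x : cent b i0 x -> coef b i0 x [~ x, b i1].
Proof. by split=> //; exists x. Qed.

Lemma coef_i1 y : cent b i1 y -> coef b i1 y [~ b i0, y].
Proof.
move=> cy; have [g yg] := coef_exists cy.
by have [_ [x0 [_ /= <- gE]]] := yg; rewrite -gE.
Qed.

Lemma scalar1 : scalar b 1.
Proof. by exists 1; split; [apply: cent1|rewrite comm1g]. Qed.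

Lemma scalarM g h : scalar b g -> scalar b h -> scalar b (g * h).
Proof.
by move=> [x [cx ->]] [y [cy ->]]; exists (x * y); split; [apply: centM|rewrite commgMl].
Qed.

Lemma scalarV g : scalar b g -> scalar b g^-1.
Proof.
by move=> [x [cx ->]]; exists x^-1; split; [apply: centV|rewrite commgVl].
Qed.

(** The type depends on the proof that [b] is a frame because its ring structure
    does. *)
Definition scalar_ring (F : frame b) : Type := {g : K | `[< scalar b g >]}.

HB.instance Definition _ F := Choice.copy (scalar_ring F) {g : K | `[< scalar b g >]}.

Local Notation scalars := (scalar_ring Fb).

Definition mk_scalar g (sg : scalar b g) : scalars := exist _ g (asboolT sg).

Definition scalar_val (r : scalars) : K := sval r.

Lemma scalar_val_inj : injective scalar_val.
Proof. exact: val_inj. Qed.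

Lemma scalar_valP (r : scalars) : scalar b (scalar_val r).
Proof. by case: r => g /= /asboolP. Qed.

Definition scalars_zero : scalars := mk_scalar scalar1.
Definition scalars_add (r s : scalars) : scalars :=
  mk_scalar (scalarM (scalar_valP r) (scalar_valP s)).
Definition scalars_opp (r : scalars) : scalars := mk_scalar (scalarV (scalar_valP r)).

Lemma scalars_addA : associative scalars_add.
Proof. by move=> r s t; apply: scalar_val_inj; rewrite /scalar_val /= mulgA. Qed.

Lemma scalars_addC : commutative scalars_add.
Proof.
move=> r s; apply: scalar_val_inj; rewrite /scalar_val /=.
exact: (scalar_central (scalar_valP r)).
Qed.

Lemma scalars_add0 : left_id scalars_zero scalars_add.
Proof. by move=> r; apply: scalar_val_inj; rewrite /scalar_val /= mul1g. Qed.

Lemma scalars_addN : left_inverse scalars_zero scalars_opp scalars_add.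
Proof. by move=> r; apply: scalar_val_inj; rewrite /scalar_val /= mulVg. Qed.

HB.instance Definition _ := GRing.isZmodule.Build scalars
  scalars_addA scalars_addC scalars_add0 scalars_addN.

Lemma scalar_val0 : scalar_val 0%R = 1. Proof. by []. Qed.
Lemma scalar_valD r s : scalar_val (r + s)%R = scalar_val r * scalar_val s. Proof. by []. Qed.

(** A section of the coordinate map of the [i]-th axis. It takes the value [1]
    at [0] because 2-cocycles are required to vanish when an argument does. *)
Definition lift_coef i (r : scalars) : K :=
  if r == 0%R then 1 else sval (cid (coef_onto i (scalar_valP r))).

Lemma lift_coef0 i : lift_coef i 0%R = 1.
Proof. by rewrite /lift_coef eqxx. Qed.

Lemma coef_lift_coef i r : coef b i (lift_coef i r) (scalar_val r).
Proof.
rewrite /lift_coef; case: eqP => [->|_]; last by case: cid.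
by apply: coef_central; apply: central1.
Qed.

Lemma cent_lift_coef i r : cent b i (lift_coef i r).
Proof. by have [] := coef_lift_coef i r. Qed.

Definition scalars_mul (r s : scalars) : scalars :=
  mk_scalar (frame_mul Fb (cent_lift_coef i0 r) (cent_lift_coef i1 s)).

(** Elements of an axis with the same coordinate differ by a central factor,
    which does not affect commutators: the product of scalars does not depend
    on the chosen representatives, whence distributivity. *)
Lemma scalars_mulE x y r s : coef b i0 x (scalar_val r) -> coef b i1 y (scalar_val s) ->
  scalar_val (scalars_mul r s) = [~ x, y].
Proof.
move=> xr ys; rewrite /scalar_val /=.
rewrite (commg_congl K2 _ (coef_inj (coef_lift_coef i0 r) xr)).
exact: (commg_congr K2 _ (coef_inj (coef_lift_coef i1 s) ys)).
Qed.

Lemma scalar_mulP r s g :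
  scalar_mul b (scalar_val r) (scalar_val s) g <-> g = scalar_val (scalars_mul r s).
Proof.
split=> [[x [y [cx cy xr ys <-]]]|->].
  by rewrite (@scalars_mulE x y) // -?xr -?ys; [apply: coef_i0|apply: coef_i1].
exists (lift_coef i0 r), (lift_coef i1 s); split=> //; try exact: cent_lift_coef.
  by apply: coef_fun (coef_i0 (cent_lift_coef i0 r)) (coef_lift_coef i0 r).
by apply: coef_fun (coef_i1 (cent_lift_coef i1 s)) (coef_lift_coef i1 s).
Qed.

Definition scalars_one : scalars :=
  mk_scalar (ex_intro _ (b i0) (conj (cent_frame i0) (erefl [~ b i0, b i1]))).

Lemma scalars_mulA : associative scalars_mul.
Proof.
move=> r s t; apply: scalar_val_inj; apply/esym.
by apply: (frame_mulA Fb) => //; apply/scalar_mulP.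
Qed.

Lemma scalars_mul1x : left_id scalars_one scalars_mul.
Proof.
move=> r; apply: scalar_val_inj.
rewrite (@scalars_mulE (b i0) (lift_coef i1 r)); [|exact/coef_i0/cent_frame|exact: coef_lift_coef].
by apply: coef_fun (coef_i1 (cent_lift_coef i1 r)) (coef_lift_coef i1 r).
Qed.

Lemma scalars_mulx1 : right_id scalars_one scalars_mul.
Proof.
move=> r; apply: scalar_val_inj.
rewrite (@scalars_mulE (lift_coef i0 r) (b i1)); [|exact: coef_lift_coef|exact/coef_i1/cent_frame].
by apply: coef_fun (coef_i0 (cent_lift_coef i0 r)) (coef_lift_coef i0 r).
Qed.

Lemma scalars_mulDl : left_distributive scalars_mul +%R.
Proof.
move=> r s t; apply: scalar_val_inj; rewrite scalar_valD.
rewrite (@scalars_mulE (lift_coef i0 r * lift_coef i0 s) (lift_coef i1 t)) ?commgMl //.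
  by rewrite scalar_valD; apply: coefM; apply: coef_lift_coef.
exact: coef_lift_coef.
Qed.

Lemma scalars_mulDr : right_distributive scalars_mul +%R.
Proof.
move=> r s t; apply: scalar_val_inj; rewrite scalar_valD.
rewrite (@scalars_mulE (lift_coef i0 r) (lift_coef i1 s * lift_coef i1 t)) ?commgMr //.
  exact: coef_lift_coef.
by rewrite scalar_valD; apply: coefM; apply: coef_lift_coef.
Qed.

HB.instance Definition _ := GRing.Zmodule_isPzRing.Build scalars
  scalars_mulA scalars_mul1x scalars_mulx1 scalars_mulDl scalars_mulDr.

Lemma scalar_valueE (rho : nat -> ring_structure scalars) t g :
  scalar_value b (fun k => scalar_val (rho k)) t g <-> g = scalar_val (eval rho t).
Proof.
elim: t g => [x|[] a IHa] g //=.
- split=> [[h [/IHa -> ->]]|->] //.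
  by eexists; split; [apply/IHa|].
- split=> [[h [k [/IHa -> [/IHa -> ->]]]]|->] //.
  by do 2!eexists; split; [apply/IHa|split; [apply/IHa|]].
- split=> [[h [k [/IHa -> [/IHa -> /scalar_mulP ->]]]]|->] //.
  by do 2!eexists; split; [apply/IHa|split; [apply/IHa|apply/scalar_mulP]].
Qed.

Lemma scalar_holdsE phi (rho : nat -> ring_structure scalars) :
  scalar_holds b (fun k => scalar_val (rho k)) phi <-> holds rho phi.
Proof.
elim: phi rho => [t u|p IHp|p IHp q IHq|p IHp q IHq|p IHp q IHq|x p IHp|x p IHp] rho /=.
- split=> [[g [/scalar_valueE -> /scalar_valueE /scalar_val_inj]]|tu] //.
  by exists (scalar_val (eval rho t)); split; apply/scalar_valueE; rewrite // tu.
- by rewrite IHp.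
- by rewrite IHp IHq.
- by rewrite IHp IHq.
- by rewrite IHp IHq.
- have upd (r : scalars) : (fun k => if k == x then scalar_val r else scalar_val (rho k)) =
      (fun k => scalar_val (update rho x r k)).
    by apply/funext => k; rewrite /update; case: eqP.
  split=> [H r|H g sg]; first by rewrite -IHp -upd; apply: H; apply: scalar_valP.
  by rewrite -[g]/(scalar_val (mk_scalar sg)) upd IHp.
- have upd (r : scalars) : (fun k => if k == x then scalar_val r else scalar_val (rho k)) =
      (fun k => scalar_val (update rho x r k)).
    by apply/funext => k; rewrite /update; case: eqP.
  split=> [[g [sg H]]|[r H]].
    by exists (mk_scalar sg); rewrite -IHp -upd.
  by exists (scalar_val r); split; [apply: scalar_valP|rewrite upd IHp].
Qed.

End ScalarRing.

(** * Coordinates *)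

Section CoordinateIsomorphism.
Local Open Scope group_scope.
Variable m : nat.
Local Notation n := m.+2.
Variables (K : groupType) (b : 'I_n -> K) (Fb : frame b).
Local Notation R := (scalar_ring Fb).
Let K2 := frame_class2 Fb.

(** The parametrization of the center by families of scalars. *)
Definition center_elt (v : {ffun opair n -> R}) : K :=
  \prod_p [~ b (val p).1, lift_coef (val p).2 (v p)].

(** Both factors lie on the [i]-th axis and have the coordinate [r + s]. *)
Lemma lift_coefD i (r s : R) :
  central ((lift_coef i (r + s)%R)^-1 * (lift_coef i r * lift_coef i s)).
Proof.
apply: (coef_inj Fb (coef_lift_coef i (r + s)%R)).
by rewrite scalar_valD; apply: (coefM Fb); apply: coef_lift_coef.
Qed.

Lemma center_eltD : {morph center_elt : u v / (u + v)%R >-> u * v}.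
Proof.
move=> u v; rewrite /center_elt -prodM_central; last by move=> p; apply: K2.
apply: eq_bigr => p _; rewrite ffunE -(commgMr K2).
exact: (commg_congr K2 _ (lift_coefD _ _ _)).
Qed.

Lemma center_elt0 : center_elt 0%R = 1.
Proof. by rewrite /center_elt big1 // => p _; rewrite ffunE lift_coef0 commg1. Qed.

Lemma center_elt_central v : central (center_elt v).
Proof. by apply: central_prod => p; apply: K2. Qed.

Lemma center_elt_inj : injective center_elt.
Proof.
have ker v : center_elt v = 1 -> v = 0%R.
  move=> v1; apply/ffunP => p; rewrite ffunE; apply: scalar_val_inj.
  apply: (coef_fun Fb (coef_lift_coef (val p).2 (v p))).
  apply: coef_central.
  by apply: (frame_center_free Fb _ v1) => q; apply: cent_lift_coef.
move=> u v uv; apply/eqP; rewrite -subr_eq0; apply/eqP/ker.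
by apply: (@mulIg _ (center_elt v)); rewrite -center_eltD subrK mul1g.
Qed.

Lemma center_elt_surj z : central z -> exists v, center_elt v = z.
Proof.
move=> /(frame_center Fb)[y [cy ->]].
have H p : exists r : R, coef b (val p).2 (y p) (scalar_val r).
  have [g yg] := coef_exists Fb (cy p).
  by exists (mk_scalar Fb (coef_scalar yg)).
have [v vP] := choice H; exists (finfun v).
apply: eq_bigr => p _; rewrite ffunE; apply: (commg_congr K2).
exact: (coef_inj Fb (coef_lift_coef _ _) (vP p)).
Qed.

(** This is [frame_comm] in terms of the ring structure; it makes products of
    coordinates appear in the group law. *)
Lemma commg_coef (i j : 'I_n) x y (r s : R) : (i < j)%N ->
  coef b i x (scalar_val r) -> coef b j y (scalar_val s) ->
  [~ x, y] = center_elt (pair_delta i j (r * s)%R).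
Proof.
move=> ij xr ys.
have -> : [~ x, y] = [~ b i, lift_coef j (r * s)%R].
  by apply: (frame_comm Fb ij xr ys _ (coef_lift_coef _ _)); apply/scalar_mulP.
pose p : opair n := exist _ (i, j) ij.
rewrite /center_elt (big_only1 p) // => [|q qp _].
  by rewrite ffunE eqxx.
rewrite ffunE; case: eqP => [qE|_]; last by rewrite lift_coef0 commg1.
by case/eqP: qp; apply: val_inj.
Qed.

Lemma lift_defect i (r s : R) :
  exists v, lift_coef i r * lift_coef i s = lift_coef i (r + s)%R * center_elt v.
Proof.
by have [v vE] := center_elt_surj (lift_coefD i r s); exists v; rewrite vE mulVKg.
Qed.

(** The [i]-th axis is an abelian extension of the scalars by the center, and
    this is its 2-cocycle for the section [lift_coef i]. Associativity of the
    group law gives the cocycle identity [defectD], commutativity of the axis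
    gives the symmetry [defectC]. *)
Definition defect i (r s : R) := sval (cid (lift_defect i r s)).

Lemma defectE i r s :
  lift_coef i r * lift_coef i s = lift_coef i (r + s)%R * center_elt (defect i r s).
Proof. by rewrite /defect; case: cid. Qed.

Lemma defect0x i r : defect i 0%R r = 0%R.
Proof.
apply: center_elt_inj; apply: (@mulgI _ (lift_coef i (0 + r)%R)).
by rewrite -defectE center_elt0 lift_coef0 add0r mulg1 mul1g.
Qed.

Lemma defectx0 i r : defect i r 0%R = 0%R.
Proof.
apply: center_elt_inj; apply: (@mulgI _ (lift_coef i (r + 0)%R)).
by rewrite -defectE center_elt0 lift_coef0 addr0 mulg1.
Qed.

Lemma defectC i r s : defect i r s = defect i s r.
Proof.
apply: center_elt_inj; apply: (@mulgI _ (lift_coef i (r + s)%R)).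
rewrite -defectE (addrC r) -defectE.
by apply: (frame_abelian Fb (i := i)); apply: cent_lift_coef.
Qed.

Lemma defectD i r s t :
  (defect i (r + s) t + defect i r s = defect i r (s + t) + defect i s t)%R.
Proof.
apply: center_elt_inj; apply: (@mulgI _ (lift_coef i (r + s + t)%R)).
rewrite !center_eltD !mulgA -defectE -[LHS]mulgA.
rewrite -(center_elt_central (defect i r s) (lift_coef i t)) mulgA -defectE.
by rewrite -[in RHS]addrA -[in RHS]defectE -!mulgA -defectE.
Qed.

Definition lift_cocycle i : sym_cocycle R {ffun opair n -> R} :=
  SymCocycle (defect0x i) (defectx0 i) (defectD i) (defectC i).

Definition of_coords (u : N2 lift_cocycle) : K :=
  prod_desc (fun i => lift_coef i (u.1 i)) * center_elt u.2.

(** Collecting the two products gives the product terms of the group law of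
    [N2], and adding the coordinates on each axis gives its cocycles. *)
Lemma of_coordsM : {morph of_coords : u v / u * v}.
Proof.
move=> u v; rewrite /of_coords.
set U := center_elt u.2; set V := center_elt v.2.
rewrite -!mulgA [U * (_ * _)]mulgA (center_elt_central u.2) -!mulgA mulgA.
rewrite /prod_desc (prodM_class2 K2 center_eltD center_elt_central _
  (q := fun i j => pair_delta i j (u.1 i * v.1 j)%R)); last 2 first.
- by move=> i j ij; apply: commg_coef => //; apply: coef_lift_coef.
- exact: pairwise_rev_enum.
under [in RHS]eq_bigr => i _ do rewrite defectE.
rewrite prodM_central; last by move=> i; apply: center_elt_central.
rewrite -(big_morph _ center_eltD center_elt0) sum_pair_delta.
rewrite -!mulgA; congr (_ * _).
  by apply: eq_bigr => i _; rewrite ffunE.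
rewrite -!center_eltD; congr center_elt; apply/ffunP => p.
rewrite !ffunE /= sum_ffunE.
have -> : (\sum_(i <- rev (enum 'I_n)) defect i (u.1 i) (v.1 i) p =
    \sum_i defect i (u.1 i) (v.1 i) p)%R.
  by rewrite (perm_big (enum 'I_n)) ?big_enum //= perm_rev.
by rewrite [RHS]addrC; congr (_ + _)%R; rewrite addrC.
Qed.

(** If the image of [u] is trivial, [frame_free] shows that its factor on each
    axis is central, hence that the coordinates of [u] on the axes vanish. *)
Lemma of_coords_inj : injective of_coords.
Proof.
have ker u : of_coords u = 1 -> u = 1.
  case: u => a c /[dup] u1; rewrite /of_coords /= => /mulg1_eq/(canRL invgK) E.
  have a0 i : a i = 0%R.
    apply: scalar_val_inj; apply: (coef_fun Fb (coef_lift_coef i (a i))).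
    apply: coef_central.
    apply: (frame_free Fb (c := fun i => lift_coef i (a i))) => [j|].
      exact: cent_lift_coef.
    by rewrite E; apply/centralV/center_elt_central.
  congr pair; first by apply/ffunP => i; rewrite a0 ffunE.
  apply: center_elt_inj; rewrite center_elt0 -u1 /of_coords /=.
  by rewrite /prod_desc big1 ?mul1g // => i _; rewrite a0 lift_coef0.
move=> u v uv; apply: divg1_eq; apply: ker; rewrite of_coordsM uv -of_coordsM mulgV.
by rewrite /of_coords center_elt0 /prod_desc big1 ?mulg1 // => i _; rewrite ffunE lift_coef0.
Qed.

Lemma of_coords_surj h : exists u, of_coords u = h.
Proof.
have [c [cP ->]] := frame_span Fb h.
have H i : exists r : R, coef b i (c i) (scalar_val r).
  have [g yg] := coef_exists Fb (cP i).
  by exists (mk_scalar Fb (coef_scalar yg)).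
have [a aP] := choice H.
have H' i : exists v, center_elt v = (lift_coef i (a i))^-1 * c i.
  apply: center_elt_surj; exact: (coef_inj Fb (coef_lift_coef _ _) (aP i)).
have [v vP] := choice H'.
exists (finfun a, \sum_(i <- rev (enum 'I_n)) v i)%R.
rewrite /of_coords /= (big_morph _ center_eltD center_elt0) /prod_desc.
rewrite -prodM_central => [|i]; last exact: center_elt_central.
by apply: eq_bigr => i _; rewrite ffunE vP mulVKg.
Qed.

Lemma frame_isomorphic :
  exists f : 'I_n -> sym_cocycle R {ffun opair n -> R}, isomorphic K (N2 f).
Proof.
exists lift_cocycle; apply/isomorphic_sym/(isomorphic_of_morph of_coordsM).
exact: bijective_of_inj_surj of_coords_inj of_coords_surj.
Qed.

End CoordinateIsomorphism.

(** * The group over the integers *)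

Definition zero_cocycle (B A : zmodType) : sym_cocycle B A :=
  @SymCocycle B A (fun _ _ => 0%R) (fun=> erefl) (fun=> erefl)
    (fun _ _ _ => erefl) (fun _ _ => erefl).

Lemma prod_desc_single (K : groupType) k (c : 'I_k -> K) i :
  (forall j, j != i -> c j = 1%g) -> prod_desc c = c i.
Proof.
move=> c1; have -> : prod_desc c = (\prod_(j <- rev (enum 'I_k) | j == i) c j)%g.
  by rewrite [RHS]big_mkcond; apply: eq_bigr => j _; case: eqP => // /eqP/c1.
rewrite -big_filter filter_pred1_uniq ?big_seq1 ?mem_rev ?mem_enum //.
by rewrite rev_uniq enum_uniq.
Qed.

Section IntegerGroup.
Local Open Scope group_scope.
Variable n : nat.

Local Notation intN2 := (N2 (fun _ : 'I_n => zero_cocycle int {ffun opair n -> int})).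
Implicit Types (u v : intN2) (p : opair n).

Lemma intN2_mul1 u v i : ((u * v)%g.1 i = u.1 i + v.1 i)%R.
Proof. by rewrite ffunE. Qed.

Lemma intN2_mul2 u v p :
  ((u * v)%g.2 p = u.2 p + v.2 p + u.1 (val p).1 * v.1 (val p).2)%R.
Proof. by rewrite ffunE big1 ?addr0 // => k _; rewrite ffunE. Qed.

Lemma intN2_eq u v : u.1 =1 v.1 -> u.2 =1 v.2 -> u = v.
Proof. by case: u v => [a c] [a' c'] /= /ffunP -> /ffunP ->. Qed.

Definition intN2_center (v : {ffun opair n -> int}) : intN2 := (0, v)%R.

Lemma intN2_centerD : {morph intN2_center : u v / (u + v)%R >-> u * v}.
Proof.
move=> u v; apply: intN2_eq => [i|p].
  by rewrite intN2_mul1 !ffunE addr0.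
by rewrite intN2_mul2 !ffunE mul0r addr0.
Qed.

Lemma intN2_center_prod (I : Type) (r : seq I) (F : I -> {ffun opair n -> int}) :
  \prod_(i <- r) intN2_center (F i) = intN2_center (\sum_(i <- r) F i)%R.
Proof. by rewrite (big_morph _ intN2_centerD (erefl : intN2_center 0%R = 1)). Qed.

Lemma intN2_commg u v : [~ u, v] =
  intN2_center [ffun p => u.1 (val p).1 * v.1 (val p).2 - v.1 (val p).1 * u.1 (val p).2]%R.
Proof.
apply: (@mulgI _ (v * u)); rewrite -commgC; apply: intN2_eq => [i|p].
  by rewrite !intN2_mul1 ffunE addr0 addrC.
rewrite !intN2_mul2 /= !ffunE; ring.
Qed.

(** Two elements commute when their images modulo the center are linearly
    dependent. *)
Lemma intN2_commute u v :
  commute u v <-> forall i j, (u.1 i * v.1 j = u.1 j * v.1 i)%R.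
Proof.
split=> [/commgP/eqP|uv].
  rewrite intN2_commg => -[/ffunP H].
  have lt_case (i j : 'I_n) : (i < j)%N -> (u.1 i * v.1 j = u.1 j * v.1 i)%R.
    move=> ij; have := H (exist _ (i, j) ij); rewrite !ffunE /= => /eqP.
    by rewrite subr_eq0 [X in _ == X]mulrC => /eqP.
  move=> i j; case: (ltngtP i j) => [/lt_case//|/lt_case/esym//|/val_inj -> //].
apply/commgP/eqP; rewrite intN2_commg; congr intN2_center.
by apply/ffunP => p; rewrite !ffunE (mulrC (v.1 _)) uv subrr.
Qed.

Lemma intN2_class2 u v : central [~ u, v].
Proof.
by rewrite intN2_commg => x; apply/intN2_commute => i j; rewrite !ffunE !mul0r.
Qed.

Lemma intN2_prod1 (I : Type) (r : seq I) (F : I -> intN2) i :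
  ((\prod_(j <- r) F j)%g.1 i = \sum_(j <- r) (F j).1 i)%R.
Proof.
by elim: r => [|j r IHr]; rewrite ?big_nil ?ffunE // !big_cons intN2_mul1 IHr.
Qed.

Definition intN2_axis i (k : int) : intN2 := ([ffun j => k *+ (j == i)], 0)%R.
Definition intN2_gen i := intN2_axis i 1.

Lemma intN2_axis1 i k j : ((intN2_axis i k).1 j = k *+ (j == i))%R.
Proof. by rewrite ffunE. Qed.

Lemma cent_axisP i x :
  commute x (intN2_gen i) <-> forall j, j != i -> x.1 j = 0%R.
Proof.
split=> [/intN2_commute xi j ji|xi].
  by have := xi j i; rewrite !intN2_axis1 eqxx (negbTE ji) mulr1 mulr0.
apply/intN2_commute => j k; rewrite !intN2_axis1.
by have [->|/xi->] := eqVneq j i; have [->|/xi->] := eqVneq k i; rewrite ?mul0r ?mulr0.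
Qed.

Lemma intN2_axis_cent i k : commute (intN2_axis i k) (intN2_gen i).
Proof. by apply/cent_axisP => j /negbTE ji; rewrite intN2_axis1 ji. Qed.

Lemma intN2_commg_axes (i j : 'I_n) x y : (i < j)%N ->
  commute x (intN2_gen i) -> commute y (intN2_gen j) ->
  [~ x, y] = intN2_center (pair_delta i j (x.1 i * y.1 j)%R).
Proof.
move=> ij /cent_axisP xi /cent_axisP yj; rewrite intN2_commg; congr intN2_center.
apply/ffunP => p; rewrite !ffunE; case: eqP => [-> /=|pij].
  by rewrite (yj i) ?mul0r ?subr0 // -val_eqE /= ltn_eqF.
have p12 := valP p; rewrite /= in p12.
have -> : (x.1 (val p).1 * y.1 (val p).2 = 0)%R.
  have [p1|/xi->] := eqVneq (val p).1 i; last by rewrite mul0r.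
  have [p2|/yj->] := eqVneq (val p).2 j; last by rewrite mulr0.
  by case: pij; rewrite -p1 -p2 -surjective_pairing.
have [p1|/yj->] := eqVneq (val p).1 j; last by rewrite mul0r subr0.
have [p2|/xi->] := eqVneq (val p).2 i; last by rewrite mulr0 subr0.
by move: p12; rewrite p1 p2 ltnNge ltnW.
Qed.

End IntegerGroup.

Section IntegerFrame.
Local Open Scope group_scope.
Variable m : nat.
Local Notation n := m.+2.
Local Notation i0 := (ord0 : 'I_n).
Local Notation i1 := (Ordinal (isT : (1 < n)%N) : 'I_n).
Local Notation intN2 := (N2 (fun _ : 'I_n => zero_cocycle int {ffun opair n -> int})).
Local Notation gen := (@intN2_gen n).
Local Notation axis := (@intN2_axis n).

Lemma intN2_centralP (z : intN2) : central z <-> forall i, z.1 i = 0%R.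
Proof.
split=> [cz i|z0 x]; last by apply/intN2_commute => i j; rewrite !z0 !mul0r.
have /cent_axisP := cz (gen (if i == i0 then i1 else i0)); apply.
by have [->|] := eqVneq i i0.
Qed.

Lemma intN2_center_surj (z : intN2) : central z -> exists v, z = @intN2_center n v.
Proof.
by move=> /intN2_centralP z0; exists z.2; apply: intN2_eq => // i; rewrite z0 ffunE.
Qed.

Lemma intN2_prod_desc1 (c : 'I_n -> intN2) i :
  (forall j, cent gen j (c j)) -> ((prod_desc c)%g.1 i = (c i).1 i)%R.
Proof.
move=> cP; rewrite intN2_prod1 (perm_big (enum 'I_n)) ?perm_rev //= big_enum /=.
rewrite (bigD1 i) //= big1 ?addr0 // => j ji.
by have /cent_axisP -> := cP j; rewrite // eq_sym.
Qed.

Local Notation unit_center k := (@intN2_center n (pair_delta i0 i1 k)).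

Lemma unit_center_inj k l : unit_center k = unit_center l -> k = l.
Proof.
by move=> [/ffunP/(_ (exist _ (i0, i1) isT))]; rewrite !ffunE.
Qed.

Lemma intN2_coefP i x g : coef gen i x g <-> cent gen i x /\ g = unit_center (x.1 i).
Proof.
have axis0 k : cent gen i0 (axis i0 k) by apply: intN2_axis_cent.
split=> [[cx [x0 [c0 sx ->]]]|[cx ->]]; split=> //.
  rewrite (intN2_commg_axes (isT : (i0 < i1)%N) c0 (cent_frame _ _)).
  move: sx; rewrite /same_coef; case: eqP => [-> ->|/eqP ii].
    by rewrite intN2_axis1 eqxx mulr1.
  have lt0i : (i0 < i)%N by rewrite lt0n.
  rewrite (intN2_commg_axes lt0i c0 (cent_frame _ _)) (intN2_commg_axes lt0i (cent_frame _ _) cx).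
  move=> [/ffunP/(_ (exist _ (i0, i) lt0i))]; rewrite !ffunE !eqxx !mulr1 mul1r => ->.
  by [].
have [ii|ii] := eqVneq i i0.
  exists x; rewrite /same_coef ii eqxx; split=> //; first by rewrite -ii.
  rewrite (intN2_commg_axes (isT : (i0 < i1)%N) _ (cent_frame _ _)); last by rewrite -ii.
  by rewrite intN2_axis1 eqxx mulr1.
exists (axis i0 (x.1 i)); split=> //.
  rewrite /same_coef (negbTE ii); have lt0i : (i0 < i)%N by rewrite lt0n.
  rewrite (intN2_commg_axes lt0i (axis0 _) (cent_frame _ _)) (intN2_commg_axes lt0i (cent_frame _ _) cx).
  by rewrite !intN2_axis1 !eqxx mulr1 mul1r.
rewrite (intN2_commg_axes (isT : (i0 < i1)%N) (axis0 _) (cent_frame _ _)).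
by rewrite !intN2_axis1 !eqxx mulr1.
Qed.

Lemma intN2_scalar_mulP g h k :
  scalar_mul gen g h k <-> exists a c,
    [/\ g = unit_center a, h = unit_center c & k = unit_center (a * c)%R].
Proof.
have lt01 : (i0 < i1)%N by [].
split=> [[x [y [cx cy <- <- <-]]]|[a [c [-> -> ->]]]].
  exists (x.1 i0), (y.1 i1).
  rewrite (intN2_commg_axes lt01 cx (cent_frame _ _)) (intN2_commg_axes lt01 (cent_frame _ _) cy).
  by rewrite (intN2_commg_axes lt01 cx cy) !intN2_axis1 !eqxx mulr1 mul1r.
exists (axis i0 a), (axis i1 c).
have c0 : cent gen i0 (axis i0 a) by apply: intN2_axis_cent.
have c1 : cent gen i1 (axis i1 c) by apply: intN2_axis_cent.
rewrite (intN2_commg_axes lt01 c0 (cent_frame _ _)) (intN2_commg_axes lt01 (cent_frame _ _) c1).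
by rewrite (intN2_commg_axes lt01 c0 c1) !intN2_axis1 !eqxx mulr1 mul1r.
Qed.

(** On the standard axes, commutators are products of coordinates
    ([intN2_commg_axes]), which reduces each condition to arithmetic of the
    integers through [intN2_coefP] and [intN2_scalar_mulP]. *)
Lemma intN2_frame : frame gen.
Proof.
have lt01 : (i0 < i1)%N by [].
have axisc i k : cent gen i (axis i k) by apply: intN2_axis_cent.
have axis1 i k : (axis i k).1 i = k by rewrite intN2_axis1 eqxx.
have central_cent i (x : intN2) : cent gen i x -> x.1 i = 0%R -> central x.
  move=> /cent_axisP cx xi; apply/intN2_centralP => j.
  by have [->|/cx] := eqVneq j i.
have prodE (y : opair n -> intN2) : (forall p, cent gen (val p).2 (y p)) ->
    \prod_p [~ gen (val p).1, y p] = @intN2_center n [ffun p => (y p).1 (val p).2].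
  move=> cy; under eq_bigr => p _ do
    rewrite (intN2_commg_axes (valP p) (cent_frame _ _) (cy p)) axis1 mul1r.
  rewrite intN2_center_prod; congr intN2_center; rewrite -[RHS]sum_pair_delta_coord.
  by apply: eq_bigr => p _; rewrite ffunE.
split.
- exact: intN2_class2.
- move=> i x y /cent_axisP cx /cent_axisP cy; apply/intN2_commute => j k.
  have [->|/[dup] /cx -> /cy ->] := eqVneq j i; last by rewrite mul0r mulr0.
  by have [->|/[dup] /cx -> /cy ->] := eqVneq k i; rewrite // mul0r mulr0.
- move=> h; pose a i := axis i (h.1 i).
  have aE i : (prod_desc a).1 i = h.1 i by rewrite intN2_prod_desc1 ?axis1 // => j; apply: axisc.
  (* the product has the right coordinates on the axes; the central factor [z]
     that is missing is put on the axis of index 0 *)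
  pose z := (prod_desc a)^-1 * h.
  have cz : central z.
    apply/intN2_centralP => i; apply: (@addrI _ (h.1 i)).
    by rewrite -{1}aE -intN2_mul1 mulVKg addr0.
  exists (fun i => a i * (if i == i0 then z else 1)); split=> [i|].
    by apply: centM; [apply: axisc|case: ifP => _; [apply: cent_central|apply: cent1]].
  rewrite /prod_desc prodM_central => [|i]; last by case: eqP => // _; apply: central1.
  have -> : \prod_(i <- rev (enum 'I_n)) (if i == i0 then z else 1) = z.
    by rewrite -/(prod_desc _) (prod_desc_single (i := i0)) // => j /negbTE ->.
  by rewrite -/(prod_desc a) mulVKg.
- move=> c cP /intN2_centralP c0 i; apply: (central_cent i) => //.
  by rewrite -intN2_prod_desc1.
- move=> i ii x c0 /cent_axisP ci; apply: (central_cent i0) => //.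
  by apply: ci; rewrite eq_sym.
- by move=> i x cx; have /(_ _)[//|_ [x0 []]] := (intN2_coefP i x (unit_center (x.1 i))).2; exists x0.
- move=> i x0 c0; exists (if i == i0 then x0 else axis i (x0.1 i0)).
  rewrite /same_coef; case: eqP => [-> //|/eqP ii]; split=> //.
  have lt0i : (i0 < i)%N by rewrite lt0n.
  by rewrite (intN2_commg_axes lt0i c0 (cent_frame _ _)) (intN2_commg_axes lt0i (cent_frame _ _) (axisc _ _)) !axis1 mulr1 mul1r.
- move=> x y cx cy; exists (axis i0 (x.1 i0 * y.1 i1)%R); split=> //.
  by rewrite (intN2_commg_axes lt01 cx cy) (intN2_commg_axes lt01 (axisc _ _) (cent_frame _ _)) !axis1 mulr1.
- move=> g1 g2 g3 h h' k k' /intN2_scalar_mulP[a [c [-> -> ->]]].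
  move=> /intN2_scalar_mulP[ac [d [/unit_center_inj <- -> ->]]].
  move=> /intN2_scalar_mulP[c' [d' [/unit_center_inj <- /unit_center_inj <- ->]]].
  move=> /intN2_scalar_mulP[a' [cd [/unit_center_inj <- /unit_center_inj <- ->]]].
  by rewrite mulrA.
- move=> i j ij x y y' g h k /intN2_coefP[cx ->] /intN2_coefP[cy ->].
  move=> /intN2_scalar_mulP[a [c [/unit_center_inj <- /unit_center_inj <- ->]]].
  move=> /intN2_coefP[cy' /unit_center_inj yE].
  rewrite (intN2_commg_axes ij cx cy) yE.
  by rewrite (intN2_commg_axes ij (cent_frame _ _) cy') axis1 mul1r.
- move=> z /intN2_center_surj[v ->]; exists (fun p => axis (val p).2 (v p)).
  split=> [p|]; first exact: axisc.
  by rewrite prodE => [|p]; [congr intN2_center; apply/ffunP => p; rewrite ffunE axis1|apply: axisc].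
- move=> y cy; rewrite prodE // => -[/ffunP y0] p.
  by apply: (central_cent (val p).2) => //; have := y0 p; rewrite !ffunE.
Qed.

End IntegerFrame.

(** * Frames over the integers *)

Section IntegerRing.
Local Open Scope ring_scope.

(** The subgroup of the integers isomorphic to the additive group of [R] has a
    generator [g]; from [1 = g *~ k] and [g * g = g *~ c] one gets
    [g = 1 * g = g *~ (c * k) = 1 *~ c], so that [1] is a generator as well. *)
Lemma ring_embedded_in_int (R : pzRingType) (f : {additive R -> int}) :
    injective f -> 1 <> 0 :> R ->
  elementarily_equivalent (ring_structure R) (ring_structure int).
Proof.
move=> fI R1.
have fM x k : f (x *~ k) = f x * k by rewrite raddfMz mulrzz.
have fnz x : x <> 0 -> f x != 0.
  by move=> x0; apply/eqP => fx; apply: x0; apply: fI; rewrite raddf0.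
have [g g0 gmin] : exists2 g, f g != 0 & forall x, f x != 0 -> (`|f g| <= `|f x|)%N.
  have ex : exists k, `[< exists2 x, f x != 0 & `|f x|%N = k >].
    by exists `|f 1%R|%N; apply/asboolP; exists 1%R => //; apply: fnz.
  case: (ex_minnP ex) => k /asboolP[g g0 <-] kmin; exists g => // x x0.
  by apply: kmin; apply/asboolP; exists x.
have gen x : exists k, x = g *~ k.
  exists (f x %/ f g)%Z; apply/eqP; rewrite -subr_eq0; apply/eqP.
  set y := x - _; apply: contrapT => /fnz.
  have yE : f y = (f x %% f g)%Z by rewrite raddfB fM mulrC.
  move=> /gmin; rewrite yE leqNgt -ltz_nat !abszE.
  by rewrite (ger0_norm (modz_ge0 _ g0)) ltz_mod.
have [k k1] := gen 1; have [c gg] := gen (g * g).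
have gc : g = 1 *~ c.
  by rewrite -[LHS]mul1r [in LHS]k1 mulrzAl gg [in RHS]k1 -!mulrzA mulrC.
pose h (j : int) : R := 1 *~ j.
have hI : injective h.
  move=> i j /(congr1 f); rewrite !fM => /mulfI; apply; exact: fnz.
have [q qK] : exists q, cancel q h.
  suff /choice[q] : forall x, exists j, h j = x by exists q.
  by move=> x; have [j ->] := gen x; exists (c * j); rewrite /h mulrzA -gc.
have hK : cancel h q by move=> j; apply: hI; rewrite qK.
apply: elementarily_equivalent_sym.
apply: (iso_elementarily_equivalent (h : ring_structure int -> ring_structure R) q qK hK).
by case=> a //=; rewrite /h ?intrN ?intrD ?intrM.
Qed.
End IntegerRing.

Section IntegerScalars.
Variable m : nat.
Local Notation n := m.+2.
Local Notation i0 := (ord0 : 'I_n).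
Local Notation i1 := (Ordinal (isT : (1 < n)%N) : 'I_n).
Local Notation intN2 := (N2 (fun _ : 'I_n => zero_cocycle int {ffun opair n -> int})).
Variables (b : 'I_n -> intN2) (Fb : frame b).

(** Otherwise [b i0] would be central as an element of two axes; its axis would
    be the whole group, which is not abelian. *)
Lemma frame_not_commute : [~ b i0, b i1]%g <> 1%g.
Proof.
move=> /eqP/commgP b01.
have c0 := frame_disjoint Fb (isT : i1 != i0) (cent_frame b i0) b01.
have : commute (intN2_gen i0) (intN2_gen i1).
  by apply: (frame_abelian Fb (i := i0)); apply/commute_sym/c0.
by move=> /intN2_commute/(_ i0 i1); rewrite !intN2_axis1.
Qed.

(** If [x] commutes with [b i0], the coordinates of [x] are proportional to
    those of [b i0], so [ [~ x, b i1] ] is proportional to [ [~ b i0, b i1] ]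
    and is determined by one of its coordinates. *)
Lemma intN2_scalars : elementarily_equivalent
  (ring_structure (scalar_ring Fb)) (ring_structure int).
Proof.
have [p pb] : exists p, [~ b i0, b i1]%g.2 p != 0%R.
  apply: contrapT => H; apply: frame_not_commute; rewrite intN2_commg.
  congr intN2_center; apply/ffunP => p; apply/eqP; apply: contrapT => /negP np.
  by apply: H; exists p; rewrite intN2_commg; move: np; rewrite !ffunE.
have [k kb] : exists k, (b i0).1 k != 0%R.
  apply: contrapT => H; move/eqP: pb; apply; rewrite intN2_commg ffunE.
  have b0 k : (b i0).1 k = 0%R.
    by apply/eqP; apply: contrapT => /negP kb; apply: H; exists k.
  by rewrite !b0 mul0r mulr0 subrr.
pose f (r : scalar_ring Fb) : int := (scalar_val r).2 p.
have fD : {morph f : r s / (r + s)%R}.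
  move=> r s; rewrite /f scalar_valD intN2_mul2.
  have /intN2_centralP -> : central (scalar_val r).
    exact: scalar_central Fb _ (scalar_valP r).
  by rewrite mul0r addr0.
have f0 : f 0%R = 0%R by rewrite /f scalar_val0 ffunE.
pose F : {additive scalar_ring Fb -> int} :=
  HB.pack f (GRing.isNmodMorphism.Build _ _ f (conj f0 fD)).
apply: (@ring_embedded_in_int _ F) => [|/(congr1 (@scalar_val _ _ _ Fb))]; last first.
  exact: frame_not_commute.
apply: raddf_inj => r; rewrite -[F r]/(f r) => fr.
apply: scalar_val_inj; have [x [cx rE]] := scalar_valP r.
rewrite /f rE intN2_commg ffunE in fr; rewrite rE scalar_val0.
have prop i : ((b i0).1 k * x.1 i = x.1 k * (b i0).1 i)%R.
  by have /intN2_commute/(_ k i) := cx; rewrite mulrC [RHS]mulrC.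
have xk : x.1 k = 0%R.
  apply: (mulIf pb); rewrite mul0r intN2_commg ffunE mulrBr !mulrA -prop.
  rewrite -(mulr0 ((b i0).1 k)) -fr mulrBr !mulrA; congr (_ - _)%R.
  by rewrite mulrAC -prop mulrAC.
rewrite commg_central_l //; apply/intN2_centralP => i.
by apply: (mulfI kb); rewrite prop xk mul0r mulr0.
Qed.
End IntegerScalars.

(** * The free 2-nilpotent group *)

Section IntegerPowers.
Local Open Scope group_scope.
Variable K : groupType.
Implicit Types x y : K.

Definition zexp x (k : int) : K :=
  match k with Posz j => x ^+ j | Negz j => x ^- j.+1 end.

Lemma zexpS x k : zexp x (k + 1)%R = zexp x k * x.
Proof.
case: k => [j|[|j]].
- by rewrite addrC -intS /= expgSr.
- by rewrite /= mulVg.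
- have -> : (Negz j.+1 + 1)%R = Negz j.
    by rewrite !NegzE (intS j.+1) opprD addrAC addNr add0r.
  by rewrite /= [x ^+ j.+2]expgS invgM mulgVK.
Qed.

Lemma zexpD x : {morph zexp x : j k / (j + k)%R >-> j * k}.
Proof.
move=> j k; elim/int_ind: k => [|k IHk|k IHk].
- by rewrite addr0 mulg1.
- by rewrite intS [(1 + _)%R]addrC addrA !zexpS IHk mulgA.
apply: (@mulIg _ x); rewrite -zexpS -mulgA -zexpS.
have -> : (- k.+1%:Z + 1 = - k%:Z)%R by rewrite intS opprD addrAC addNr add0r.
by rewrite -addrA (_ : - k.+1%:Z + 1 = - k%:Z)%R // intS opprD addrAC addNr add0r.
Qed.

(** The integers are generated by [1], so identities between powers only have
    to be checked for the exponent [1]. *)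
Lemma zexp_morph_ext (f g : int -> K) :
  {morph f : j k / (j + k)%R >-> j * k} -> {morph g : j k / (j + k)%R >-> j * k} ->
  f 1%R = g 1%R -> f =1 g.
Proof.
move=> fD gD fg1.
have h0 (h : int -> K) : {morph h : j k / (j + k)%R >-> j * k} -> h 0%R = 1.
  by move=> hD; apply: (@mulgI _ (h 0%R)); rewrite -hD addr0 mulg1.
elim/int_ind => [|k IHk|k IHk]; first by rewrite !h0.
  by rewrite intS fD gD fg1 IHk.
apply: (@mulIg _ (f 1%R)); rewrite {2}fg1 -fD -gD.
by rewrite (_ : - k.+1%:Z + 1 = - k%:Z)%R // intS opprD addrAC addNr add0r.
Qed.

Lemma zexp_commg x y j k : (forall u v : K, central [~ u, v]) ->
  [~ zexp x j, zexp y k] = zexp [~ x, y] (j * k)%R.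
Proof.
move=> K2; move: k; apply: zexp_morph_ext => [u v|u v|].
- by rewrite zexpD commgMr.
- by rewrite mulrDr zexpD.
move: j; apply: zexp_morph_ext => [u v|u v|].
- by rewrite zexpD commgMl.
- by rewrite mulrDl zexpD.
by rewrite mulr1.
Qed.

Lemma central_zexp x k : central x -> central (zexp x k).
Proof.
move=> cx; have cX j : central (x ^+ j).
  by elim: j => [|j IHj]; [apply: central1|rewrite expgS; apply: centralM].
by case: k => j; [apply: cX|apply/centralV/cX].
Qed.

End IntegerPowers.

Section FreeClassTwo.
Local Open Scope quotient_scope.
Local Open Scope group_scope.
Variable n : nat.
Local Notation gamma3 := (normal_lower_central (free_group n) 3).
Local Notation intN2 := (N2 (fun _ : 'I_n => zero_cocycle int {ffun opair n -> int})).

(** The universal property: a family of elements in a group of class two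
    extends to the free 2-nilpotent group, by evaluating words. *)
Section Universal.
Variables (K : groupType) (x : 'I_n -> K).

Definition word_value (w : word n) : K :=
  \prod_(a <- w) (if a.2 then x a.1 else (x a.1)^-1).

Lemma word_value_equiv w w' : free_equiv w w' -> word_value w = word_value w'.
Proof.
elim=> {w w'} [u v a|//|u v _ -> //|u v w _ -> _ -> //].
rewrite /word_value !big_cat !big_cons /=; congr (_ * _); rewrite mulgA.
by case: a.2; rewrite /= ?mulgV ?mulVg mul1g.
Qed.

Definition free_value (h : free_group n) : K := word_value (repr h).

Lemma free_valueE w : free_value (\pi_(free_group n) w) = word_value w.
Proof. exact/esym/word_value_equiv/free_reprP. Qed.

Lemma free_valueM : {morph free_value : g h / g * h}.
Proof.
elim/quotW => u; elim/quotW => v.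
by rewrite [_ * _]free_mulE !free_valueE /word_value big_cat.
Qed.

Lemma free_value1 : free_value 1 = 1.
Proof. by rewrite -[1]/(\pi_(free_group n) [::]) free_valueE /word_value big_nil. Qed.

Lemma free_valueV h : free_value h^-1 = (free_value h)^-1.
Proof. by apply: (@mulIg _ (free_value h)); rewrite -free_valueM !mulVg free_value1. Qed.

Lemma free_valueR g h : free_value [~ g, h] = [~ free_value g, free_value h].
Proof. by rewrite !free_valueM !free_valueV. Qed.

Hypothesis K2 : forall u v : K, central [~ u, v].

(** Commutators go to central elements, so commutators of commutators with
    arbitrary elements go to [1]. *)
Lemma free_value_gamma3 h : lower_central (G := free_group n) 3 h -> free_value h = 1.
Proof.
have gamma2 g : lower_central (G := free_group n) 2 g -> central (free_value g).
  move=> Hg; apply: (Hg (fun g => central (free_value g))); split.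
    split=> [|g1 g2|g1]; rewrite ?free_value1 ?free_valueM ?free_valueV.
    - exact: central1.
    - exact: centralM.
    - exact: centralV.
  by move=> g' [g1 _ [g2 _ ->]]; rewrite free_valueR; apply: K2.
move=> Hh; apply: (Hh (fun g => free_value g = 1)); split.
  split=> [|g1 g2 e1 e2|g1 e1]; rewrite ?free_value1 ?free_valueM ?free_valueV //.
  - by rewrite e1 e2 mulg1.
  - by rewrite e1 invg1.
move=> g' [g1 /gamma2 c1 [g2 _ ->]]; rewrite free_valueR; exact: commg_central_l.
Qed.

Definition free2_value (h : free_2nilpotent n) : K := free_value (repr h).

Lemma free2_valueE (g : free_group n) :
  free2_value (\pi_(quotient_group gamma3) g) = free_value g.
Proof.
have /free_value_gamma3 := coset_reprP (normal_lower_central (free_group n) 3) g.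
by rewrite free_valueM free_valueV => /mulg1_eq; rewrite invgK.
Qed.

End Universal.

Definition free2_class (w : word n) : free_2nilpotent n :=
  \pi_(quotient_group gamma3) (\pi_(free_group n) w).

Lemma free2_classP (h : free_2nilpotent n) : exists w, h = free2_class w.
Proof. by elim/quotW: h; elim/quotW => w; exists w. Qed.

Lemma free2_classM w w' : free2_class (w ++ w') = free2_class w * free2_class w'.
Proof. by rewrite /free2_class -free_mulE -quotient_mulE. Qed.

Lemma free2_classV w : free2_class (word_inv w) = (free2_class w)^-1.
Proof. by rewrite /free2_class -free_invE -quotient_invE. Qed.

Lemma free2_class2 (u v : free_2nilpotent n) : central [~ u, v].
Proof.
move=> z; apply/commgP/eqP; move: u v z.
elim/quotW => u; elim/quotW => v; elim/quotW => z.
have piM g h : \pi_(quotient_group gamma3) g * \pi_(quotient_group gamma3) h =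
  \pi_(quotient_group gamma3) (g * h) := quotient_mulE _ _ _.
have piR g h : [~ \pi_(quotient_group gamma3) g, \pi_(quotient_group gamma3) h] =
    \pi_(quotient_group gamma3) [~ g, h].
  apply: (@mulgI _ (\pi_(quotient_group gamma3) h * \pi_(quotient_group gamma3) g)).
  by rewrite -commgC (piM g h) (piM h g) (piM (h * g)) -commgC.
rewrite (piR u v) (piR _ z); apply: coset_piP; rewrite mulg1.
have [_ _ AV] := (normal_lower_central (free_group n) 3).1; apply: AV.
move=> A [_ SA]; apply: SA; exists [~ u, v]; last by exists z.
by move=> B [_ SB]; apply: SB; exists u => //; exists v.
Qed.

Section Substitution.
Variables (K : groupType) (x : 'I_n -> K).
Hypothesis K2 : forall u v : K, central [~ u, v].

Lemma free2_value_class w : free2_value x (free2_class w) = word_value x w.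
Proof. by rewrite free2_valueE // free_valueE. Qed.

Lemma free2_valueM : {morph free2_value x : g h / g * h}.
Proof.
move=> g h; have [u ->] := free2_classP g; have [v ->] := free2_classP h.
by rewrite -free2_classM !free2_value_class /word_value big_cat.
Qed.

Definition center_value (v : {ffun opair n -> int}) : K :=
  \prod_p zexp [~ x (val p).1, x (val p).2] (v p).

Lemma center_valueD : {morph center_value : u v / (u + v)%R >-> u * v}.
Proof.
move=> u v; rewrite /center_value -prodM_central; last by move=> p; apply/central_zexp/K2.
by apply: eq_bigr => p _; rewrite ffunE zexpD.
Qed.

Lemma center_value_central v : central (center_value v).
Proof. by apply: central_prod => p; apply/central_zexp/K2. Qed.

Lemma center_value_delta (i j : 'I_n) k : (i < j)%N ->
  center_value (pair_delta i j k) = zexp [~ x i, x j] k.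
Proof.
move=> ij; pose p : opair n := exist _ (i, j) ij.
rewrite /center_value (big_only1 p) // => [|q qp _]; first by rewrite ffunE eqxx.
rewrite ffunE; case: eqP => // qE; case/eqP: qp; exact: val_inj.
Qed.

(** The homomorphism sending the generator [i] to [x i], in normal form. *)
Definition intN2_value (u : intN2) : K :=
  prod_desc (fun i => zexp (x i) (u.1 i)) * center_value u.2.

Lemma intN2_valueM : {morph intN2_value : u v / u * v}.
Proof.
move=> u v; rewrite /intN2_value.
set U := center_value u.2; set V := center_value v.2.
rewrite -!mulgA [U * (_ * _)]mulgA (center_value_central u.2) -!mulgA mulgA.
rewrite /prod_desc (prodM_class2 K2 center_valueD center_value_central _
  (q := fun i j => pair_delta i j (u.1 i * v.1 j)%R)); last 2 first.
- by move=> i j ij; rewrite zexp_commg // center_value_delta.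
- exact: pairwise_rev_enum.
rewrite sum_pair_delta -!mulgA; congr (_ * _).
  by apply: eq_bigr => i _; rewrite intN2_mul1 zexpD.
rewrite -!center_valueD; congr center_value; apply/ffunP => p.
by rewrite intN2_mul2 !ffunE addrC.
Qed.

Lemma intN2_value_gen i : intN2_value (intN2_gen i) = x i.
Proof.
rewrite /intN2_value [center_value _]big1 ?mulg1 => [|p _]; last by rewrite ffunE.
rewrite (prod_desc_single (i := i)) => [|j ji]; first by rewrite intN2_axis1 eqxx.
by rewrite intN2_axis1 (negbTE ji).
Qed.

End Substitution.

Section Naturality.
Variables (K L : groupType) (f : K -> L).
Hypothesis fM : {morph f : u v / u * v}.

Let f1 : f 1 = 1.
Proof. by apply: (@mulgI _ (f 1)); rewrite -fM !mulg1. Qed.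

Let fV u : f u^-1 = (f u)^-1.
Proof. by apply: (@mulgI _ (f u)); rewrite -fM !mulgV f1. Qed.

Lemma morph_word_value x w : f (word_value x w) = word_value (fun i => f (x i)) w.
Proof.
rewrite /word_value (big_morph f fM f1); apply: eq_bigr => a _.
by case: a.2.
Qed.

Lemma morph_zexp u k : f (zexp u k) = zexp (f u) k.
Proof.
move: k; apply: zexp_morph_ext => [j k|j k|//]; by rewrite zexpD ?fM.
Qed.

Lemma morph_intN2_value x u : f (intN2_value x u) = intN2_value (fun i => f (x i)) u.
Proof.
rewrite /intN2_value fM /prod_desc /center_value !(big_morph f fM f1).
congr (_ * _); apply: eq_bigr => i _; rewrite morph_zexp //.
by rewrite !fM !fV.
Qed.

End Naturality.

Lemma intN2_axisD i : {morph @intN2_axis n i : j k / (j + k)%R >-> j * k}.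
Proof.
move=> j k; apply: intN2_eq => [l|p].
  by rewrite intN2_mul1 !intN2_axis1 mulrnDl.
rewrite intN2_mul2 !ffunE !add0r; case: eqP => [p1|]; last by rewrite mul0r.
by case: eqP => [p2|]; [have := valP p; rewrite /= p1 p2 ltnn|rewrite mulr0].
Qed.

Lemma zexp_gen i k : zexp (@intN2_gen n i) k = intN2_axis i k.
Proof.
move: k; apply: zexp_morph_ext => [j k|j k|//]; [exact: zexpD|exact: intN2_axisD].
Qed.

Lemma intN2_prod_desc_axis (a : 'I_n -> int) :
  prod_desc (fun i => @intN2_axis n i (a i)) = (finfun a, 0%R).
Proof.
apply: intN2_eq => [i|p].
  rewrite /prod_desc intN2_prod1 (perm_big (enum 'I_n)) ?perm_rev //= big_enum /=.
  rewrite (bigD1 i) //= big1 ?addr0 ?ffunE ?eqxx // => j ji.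
  by rewrite ffunE eq_sym (negbTE ji).
rewrite /prod_desc ffunE; have := pairwise_rev_enum n.
elim: (rev _) => [|j l IHl]; first by rewrite big_nil ffunE.
rewrite /= => /andP[/allP jl /IHl{}IHl]; rewrite big_cons intN2_mul2 IHl ffunE !add0r.
rewrite intN2_axis1; case: eqP => [p1|]; last by rewrite mul0r.
rewrite intN2_prod1 big1_seq ?mulr0 // => i /= il; rewrite ffunE; case: eqP => // p2.
by have := valP p; rewrite /= p1 p2 ltnNge ltnW // jl.
Qed.

(** The normal form of an element has its own coordinates as exponents, because
    in decreasing order the powers of the generators multiply without
    contributing to the center. *)
Lemma intN2_value_id u : intN2_value (@intN2_gen n) u = u.
Proof.
rewrite /intN2_value.
have -> : prod_desc (fun i => zexp (@intN2_gen n i) (u.1 i)) = (u.1, 0%R) :> intN2.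
  under [prod_desc _]eq_bigr => i _ do rewrite zexp_gen.
  rewrite -/(prod_desc _) intN2_prod_desc_axis; congr pair.
  by apply/ffunP => i; rewrite ffunE.
have -> : center_value (@intN2_gen n) u.2 = intN2_center u.2.
  have cE (p : opair n) k : zexp [~ @intN2_gen n (val p).1, @intN2_gen n (val p).2] k =
      intN2_center (pair_delta (val p).1 (val p).2 k).
    move: k; apply: zexp_morph_ext => [j k|j k|]; first exact: zexpD.
      rewrite -intN2_centerD; congr intN2_center.
      by apply/ffunP => q; rewrite !ffunE; case: eqP; rewrite ?addr0.
    rewrite (intN2_commg_axes (valP p)); try exact: commute_refl.
    by rewrite !intN2_axis1 !eqxx.
  rewrite /center_value; under eq_bigr => p _ do rewrite cE.
  by rewrite intN2_center_prod sum_pair_delta_coord.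
apply: intN2_eq => [i|p]; first by rewrite intN2_mul1 !ffunE addr0.
by rewrite intN2_mul2 !ffunE mulr0 add0r addr0.
Qed.

(** Both groups have homomorphisms to any group of class two with prescribed
    images of the generators ([free2_value] and [intN2_value]). The two
    homomorphisms between them that match the generators are inverse to each
    other, because their composites fix the generators. *)
Lemma free_2nilpotent_intN2 : isomorphic (free_2nilpotent n) intN2.
Proof.
pose x i := free2_class [:: (i, true)].
have xE w : word_value x w = free2_class w.
  elim: w => [|[i []] w IHw]; first by rewrite /word_value big_nil.
    by rewrite /word_value big_cons -/(word_value x w) IHw -free2_classM.
  by rewrite /word_value big_cons -/(word_value x w) IHw /x -free2_classV -free2_classM.
have phiM := free2_valueM (@intN2_gen n) (@intN2_class2 n).
apply: (isomorphic_of_morph phiM).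
exists (intN2_value x) => [h|u].
  have [w ->] := free2_classP h; rewrite free2_value_class; last exact: intN2_class2.
  rewrite (morph_word_value (intN2_valueM x free2_class2)) -xE.
  by apply: eq_bigr => a _; rewrite intN2_value_gen.
have xgen i : free2_value (@intN2_gen n) (x i) = intN2_gen i.
  rewrite free2_value_class; last exact: intN2_class2.
  by rewrite /word_value big_seq1.
have -> : free2_value (@intN2_gen n) (intN2_value x u) =
    intN2_value (fun i => free2_value (@intN2_gen n) (x i)) u.
  exact: (morph_intN2_value phiM).
by rewrite (funext xgen); apply: intN2_value_id.
Qed.

End FreeClassTwo.

(** * The structure theorem *)

Theorem theorem6p9 (n : nat) (n_ge2 : (2 <= n)%N) (G : groupType)
    (G_free : isomorphic G (free_2nilpotent n)) (H : groupType)
    (H_equiv : elementarily_equivalent (group_structure H) (group_structure G)) :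
  exists R : pzRingType,
    elementarily_equivalent (ring_structure R) (ring_structure int) /\
    exists f : 'I_n -> sym_cocycle R {ffun opair n -> R},
      isomorphic H (N2 f).
Proof.
case: n n_ge2 G_free => [|[|m]] // _ G_free.
have HZ := elementarily_equivalent_trans H_equiv
  (elementarily_equivalent_trans (isomorphic_elementarily_equivalent G_free)
    (isomorphic_elementarily_equivalent (free_2nilpotent_intN2 m.+2))).
have [b Fb] := definable_transfer (definable_has_frame m) HZ
  (ex_intro _ _ (intN2_frame m)).
exists (scalar_ring Fb); split; last exact: frame_isomorphic.
apply: elementarily_equivalent_sym.
apply: (@elementarily_equivalentP _ (ring_structure int)
  (ring_structure (scalar_ring Fb)) 0%R 0%R) => phi sphi Zphi.
apply/(sentence_models (M := ring_structure (scalar_ring Fb)) (fun=> 0%R)) => //.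
apply/scalar_holdsE.
apply: (definable_transfer (definable_all_scalar_rings m phi) HZ) Fb => c Fc.
apply/(scalar_holdsE (Fb := Fc) phi (fun=> 0%R)).
by apply/sentence_models => //; apply/(intN2_scalars Fc).
Qed.
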